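(* Let $k$ be an infinite field with $\operatorname{char}k\ne 2$, and let $G=\langle\rho,\tau\rangle\simeq D_4$ act on the rational function field $k(x_1,x_2,x_3,x_4,x_5)$ by the $k$-automorphisms $$\rho: x_1\mapsto x_2,\ x_2\mapsto x_1,\ x_3\mapsto\frac{1}{x_1x_2x_3},\ x_4\mapsto x_5,\ x_5\mapsto\frac1{x_4},$$ $$\tau: x_1\mapsto x_3,\ x_2\mapsto\frac{1}{x_1x_2x_3},\ x_3\mapsto x_1,\ x_4\mapsto x_5,\ x_5\mapsto x_4.$$ Then $k(x_1,x_2,x_3,x_4,x_5)^G$ is not retract $k$-rational. In particular, it is not $k$-rational.
   Context: $D_4$ is the dihedral group of order 8. For an infinite field $k$, a field extension $L/k$ is retract $k$-rational if $L$ is the quotient field of a domain $A$ with $k\subset A\subset L$ such that there exist a polynomial ring $k[X_1,\ldots,X_m]$, a nonzero $f\in k[X_1,\ldots,X_m]$ and $k$-algebra morphisms $\varphi:A\to k[X_1,\ldots,X_m][1/f]$, $\psi:k[X_1,\ldots,X_m][1/f]\to A$ with $\psi\circ\varphi=\mathrm{id}_A$. $k$-rational means purely transcendental over $k$. *)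

(* Defs.v *)
From HB Require Import structures.
From mathcomp Require Import all_boot all_order all_algebra.
From mathcomp Require Import all_fingroup all_solvable.
From mathcomp Require Import fraction mpoly.
From mathcomp Require Import boolp classical_sets cardinality.

Set Implicit Arguments.
Unset Strict Implicit.
Unset Printing Implicit Defensive.

Import GRing.Theory.
Local Open Scope ring_scope.

Definition ratfun (k : fieldType) (n : nat) : fieldType :=
  {fraction {mpoly k[n]}}.

Definition ratX (k : fieldType) (n : nat) (i : 'I_n) : ratfun k n :=
  tofrac ('X_i : {mpoly k[n]}).

Definition ratC (k : fieldType) (n : nat) : {rmorphism k -> ratfun k n} :=
  (@tofrac {mpoly k[n]} \o @mpolyC n k : {rmorphism k -> {fraction {mpoly k[n]}}}).

(* A field extension L/k is represented by its structure morphism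
   iota : k -> L. *)

(* A left action of G on K by k-automorphisms; each act g is bijective, with
   inverse act g^-1. *)
Record kaction (k K : fieldType) (iota : {rmorphism k -> K})
    (G : finGroupType) := KAction {
  kact :> G -> {rmorphism K -> K};
  kact_const : forall g c, kact g (iota c) = iota c;
  kact1 : forall z, kact 1%g z = z;
  kactM : forall g h z, kact (g * h)%g z = kact g (kact h z)
}.

Section FixedField.
Variables (k K : fieldType) (iota : {rmorphism k -> K}) (G : finGroupType).
Variable act : kaction iota G.

Definition fixed : {pred K} := [pred z | [forall g, act g z == z]].

Lemma fixedP z : reflect (forall g, act g z = z) (z \in fixed).
Proof. by apply: (iffP forallP) => fz g; apply/eqP. Qed.

Lemma fixed_divring_closed : divring_closed fixed.
Proof.
split=> [|x y /fixedP fx /fixedP fy|x y /fixedP fx /fixedP fy]; apply/fixedP=> g.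
- by rewrite rmorph1.
- by rewrite rmorphB fx fy.
- by rewrite fmorph_div fx fy.
Qed.

HB.instance Definition _ :=
  GRing.isDivringClosed.Build K fixed fixed_divring_closed.

Record fixed_field := FixedField { fixed_val : K; _ : fixed_val \in fixed }.

HB.instance Definition _ := [isSub for fixed_val].
HB.instance Definition _ := [Choice of fixed_field by <:].
HB.instance Definition _ := [SubChoice_isSubIntegralDomain of fixed_field by <:].
HB.instance Definition _ := [SubIntegralDomain_isSubField of fixed_field by <:].

Lemma fixed_const_subproof c : iota c \in fixed.
Proof. by apply/fixedP=> g; rewrite kact_const. Qed.

Definition fixed_const_fun c : fixed_field := FixedField (fixed_const_subproof c).

Lemma fixed_const_is_zmod_morphism : zmod_morphism fixed_const_fun.
Proof. by move=> a b; apply: val_inj; rewrite /= !rmorphB. Qed.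

Lemma fixed_const_is_monoid_morphism : monoid_morphism fixed_const_fun.
Proof.
by split=> [|a b]; apply: val_inj; rewrite /= ?rmorph1 ?rmorphM.
Qed.

HB.instance Definition _ := GRing.isZmodMorphism.Build k fixed_field
  fixed_const_fun fixed_const_is_zmod_morphism.
HB.instance Definition _ := GRing.isMonoidMorphism.Build k fixed_field
  fixed_const_fun fixed_const_is_monoid_morphism.

Definition fixed_const : {rmorphism k -> fixed_field} := fixed_const_fun.

End FixedField.

Section Subring.
Variables (R : comNzRingType) (S : subringClosed R).

Record subring := Subring { subring_val : R; _ : subring_val \in S }.

HB.instance Definition _ := [isSub for subring_val].
HB.instance Definition _ := [Choice of subring by <:].
HB.instance Definition _ := [SubChoice_isSubComNzRing of subring by <:].

End Subring.

Section Localization.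
Variables (k : fieldType) (m : nat) (f : {mpoly k[m]}).

(* k[X_1, ..., X_m][1/f] inside k(X_1, ..., X_m), for nonzero f *)
Definition locp : {pred ratfun k m} :=
  [pred z | `[< exists (p : {mpoly k[m]}) (n : nat),
                  z = tofrac p / tofrac f ^+ n >]].

Lemma locpP z :
  reflect (exists (p : {mpoly k[m]}) (n : nat), z = tofrac p / tofrac f ^+ n)
          (z \in locp).
Proof. exact: asboolP. Qed.

Hypothesis f0 : f != 0.

Lemma locp_subring_closed : subring_closed locp.
Proof.
have F0 n : tofrac f ^+ n != 0 by rewrite expf_neq0 // tofrac_eq0.
split=> [|_ _ /locpP[p [i ->]] /locpP[q [j ->]]
         |_ _ /locpP[p [i ->]] /locpP[q [j ->]]]; apply/locpP.
- by exists 1, 0; rewrite expr0 divr1 tofrac1.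
- exists (p * f ^+ j - q * f ^+ i), (i + j)%N.
  by rewrite -mulNr addf_div // tofracB !tofracM !tofracXn exprD mulNr.
- by exists (p * q), (i + j)%N; rewrite mulf_div tofracM exprD.
Qed.

Definition loc : subringClosed (ratfun k m) :=
  HB.pack locp
    (GRing.isSubringClosed.Build (ratfun k m) locp locp_subring_closed).

End Localization.

Section Rationality.
Variables (k L : fieldType) (iota : {rmorphism k -> L}).

Definition retract_rational : Prop :=
  exists A : subringClosed L,
    [/\ forall c, iota c \in A,
        forall z, exists a b, [/\ a \in A, b \in A, b != 0 & z = a / b]
      & exists (m : nat) (f : {mpoly k[m]}) (f0 : f != 0)
               (phi : {rmorphism subring A -> subring (loc f0)})
               (psi : {rmorphism subring (loc f0) -> subring A}),
          [/\ forall a c, val a = iota c -> val (phi a) = ratC k m c,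
              forall b c, val b = ratC k m c -> val (psi b) = iota c
            & forall a, psi (phi a) = a]].

(* Tuples of distinct elements of a possibly infinite B are injective maps
   s : 'I_n -> L, and mmap iota s p is p evaluated at s. *)
Definition alg_independent (B : set L) : Prop :=
  forall (n : nat) (s : 'I_n -> L), injective s -> (forall i, B (s i)) ->
  forall p : {mpoly k[n]}, mmap iota s p = 0 -> p = 0.

Definition field_generated (B : set L) : Prop :=
  forall z, exists (n : nat) (s : 'I_n -> L) (p q : {mpoly k[n]}),
    [/\ forall i, B (s i), mmap iota s q != 0
      & z = mmap iota s p / mmap iota s q].

Definition rational : Prop :=
  exists B : set L, alg_independent B /\ field_generated B.

End Rationality.

(* Main.v *)
Require Import Defs.
From HB Require Import structures.
From mathcomp Require Import all_boot all_order all_algebra.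
From mathcomp Require Import all_fingroup all_solvable.
From mathcomp Require Import fraction mpoly.
From mathcomp Require Import boolp classical_sets cardinality.
From mathcomp Require Import generic_quotient finmap qpoly fieldext ring zify.

(**
  With S = (x4-1)/(x4+1), T = (x5-1)/(x5+1) and u4 = 1/(x1x2x3), the group
  permutes x1, x2, x3, u4 through its quotient V4 and acts on S, T by its linear
  representation.  Let L be the fixed field, a = (S^2-T^2)^2, b = (2ST)^2,
  c = 2+x1x3+x2u4 and d = 2+x1u4+x2x3.  In Br(L) one has
  (a,b) = (b,c) = (a,d) = 0 and (a,c) = (b,d), and these relations alone force
  every residue of (a,c) to vanish once -1 is a square.

  If L is retract rational (or rational), evaluate the relations on the line
  joining the generic point of L to a k-point of affine space: on this line the
  symbol (a,c) becomes an unramified symbol over E(t), for E containing L, hence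
  is constant by Legendre's descent, hence is split once E contains the square
  roots of -1 and of the value of a at the k-point.

  On the other hand (a,c) does not split over L k' for any extension k'/k.
  A splitting is an element Y of k'(x1,...,x5), fixed by sigma = rho tau, with
  Y rho(Y) = c.  Writing k'(x1,...,x5) = k'(m)(h)(f)(R)(T) with m = x1u4,
  h = x1x2, f = x1, R = S/T, the variables T, R, f are eliminated one after the
  other by unique factorisation in one variable, and what remains is a pair of
  norm equations over k'(m)(h) in which an exponent has to be both odd and even.
*)

Set Implicit Arguments.
Unset Strict Implicit.
Unset Printing Implicit Defensive.

Import GRing.Theory.
Local Open Scope ring_scope.

(** A retraction gives no isomorphism with a rational function field: only finitely many elements,
    and identities between them, can be carried to polynomials. The Brauer class is therefore
    handled through explicit points on four conics, and [liftable] is all that is extracted from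
    either notion. Rationality is treated directly, since its transcendence basis may a priori be
    infinite. Residues at the irreducible polynomials of E[t] suffice, because the descent lowers
    degrees. A square root of -1 serves twice: for the sign of the tame symbol, and to turn a = s^2
    + c q into a point on the conic of (a, c q). The field k' depends on the chosen k-point, and E
    on k'; this is why non-splitting has to be known over every extension k'/k. E is the fixed field
    of rho and sigma in k'(x1,...,x5). In that larger field S^2 - T^2 is a square root of a which
    rho negates and sigma fixes, so a splitting of (a,c) over E is a norm equation. *)

Definition qsplit (R : comNzRingType) (u v : R) : Prop :=
  exists x y z, [|| x != 0, y != 0 | z != 0] /\
    x ^+ 2 = u * y ^+ 2 + v * z ^+ 2.

Lemma qsplitC (R : comNzRingType) (u v : R) : qsplit u v -> qsplit v u.
Proof.
move=> [x [y [z [nz e]]]]; exists x, z, y; split; last by rewrite e addrC.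
by move: nz; do 3! case: eqP.
Qed.

Lemma qsplit_sq (R : comNzRingType) (s v : R) : qsplit (s ^+ 2) v.
Proof. by exists s, 1, 0; rewrite oner_neq0 orbT; split=> //; ring. Qed.

(** * Split symbols over a field, as conics with a point *)

Section Symbols.
Variable F : fieldType.
Implicit Types u v w s : F.

(** Dividing by [z] displays [v] as a norm from F(sqrt u); when [z] is 0 the equation itself makes
    [u] a square. *)
Lemma qsplit_norm u v : v != 0 -> qsplit u v ->
  (exists s, u = s ^+ 2) \/ exists x y, v = x ^+ 2 - u * y ^+ 2.
Proof.
move=> v0 [x [y [z [nz e]]]]; have [z0|z0] := eqVneq z 0.
  have [y0|y0] := eqVneq y 0.
    move: nz e; rewrite y0 z0 eqxx /= !orbF => x0 /eqP.
    by rewrite expr0n /= !mulr0 addr0 expf_eq0 /= (negPf x0).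
  by left; exists (x / y); rewrite expr_div_n e z0; field.
by right; exists (x / z), (y / z); rewrite !expr_div_n e; field.
Qed.

Lemma norm_qsplit u v x y : v = x ^+ 2 - u * y ^+ 2 -> qsplit u v.
Proof.
by move=> ->; exists x, y, 1; rewrite oner_neq0 !orbT; split=> //; ring.
Qed.

Lemma qsplitM u v w : v != 0 -> w != 0 ->
  qsplit u v -> qsplit u w -> qsplit u (v * w).
Proof.
move=> v0 w0 /(qsplit_norm v0)[[s ->] _|[x [y ev]]]; first exact: qsplit_sq.
case/(qsplit_norm w0)=> [[s ->]|[x' [y' ew]]]; first exact: qsplit_sq.
apply: (@norm_qsplit _ _ (x * x' + u * y * y') (x * y' + x' * y)).
by rewrite ev ew; ring.
Qed.

Lemma qsplit_mulsq u v s : s != 0 -> qsplit u (v * s ^+ 2) <-> qsplit u v.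
Proof.
move=> s0; split=> -[x [y [z [nz e]]]].
  exists x, y, (s * z); split; last by rewrite e; ring.
  by rewrite mulf_eq0 (negPf s0).
exists x, y, (z / s); split; last by rewrite e; field.
by rewrite mulf_eq0 invr_eq0 (negPf s0) orbF.
Qed.

(** For cancellation, multiply by [v] once more: the resulting factor v^2 does not change the
    conic. *)
Lemma qsplit_mulr u v w : v != 0 -> w != 0 -> qsplit u v ->
  (qsplit u (v * w) <-> qsplit u w).
Proof.
move=> v0 w0 suv; split=> [suvw|]; last exact: qsplitM.
apply/(@qsplit_mulsq u w v v0); rewrite (_ : _ * _ = v * (v * w)); last by ring.
by apply: qsplitM => //; apply: mulf_neq0.
Qed.

End Symbols.

Definition square_mod (F : fieldType) (p u : {poly F}) : Prop :=
  exists s, p %| u - s ^+ 2.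

(** * Valuations and square classes at an irreducible polynomial *)

Section PrimeDecomposition.
Variables (F : fieldType) (p : {poly F}).
Hypothesis irr_p : irreducible_poly p.
Implicit Types a u v x y z s : {poly F}.

Lemma irredp_Euclid u v : p %| u * v -> (p %| u) || (p %| v).
Proof.
move=> puv; case: (boolP (p %| u)) => //= npu.
by rewrite -(Gauss_dvdpr _ (_ : coprimep p u)) // irreducible_poly_coprime.
Qed.

Lemma irredp_ndvdM u v : ~~ (p %| u) -> ~~ (p %| v) -> ~~ (p %| u * v).
Proof. by move=> pu pv; apply/negP=> /irredp_Euclid; rewrite (negPf pu) (negPf pv). Qed.

Lemma irredp_ndvd1 : ~~ (p %| 1).
Proof. by rewrite dvdp1; case: irr_p => + _; case: (size p) => [|[]]. Qed.

Lemma irredp_dvdX u n : p %| u ^+ n -> p %| u.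
Proof.
elim: n => [|n IH]; last by rewrite exprS => /irredp_Euclid/orP[//|/IH].
by rewrite expr0 (negPf irredp_ndvd1).
Qed.

Lemma irredp_decomp a : a != 0 -> exists n u, ~~ (p %| u) /\ a = p ^+ n * u.
Proof.
have [m] := ubnP (size a); elim: m a => // m IH a sa a0.
have [/dvdpP[b eb]|npa] := boolP (p %| a); last by exists 0, a; rewrite expr0 mul1r.
have b0 : b != 0 by apply: contraNneq a0 => b0; rewrite eb b0 mul0r.
have p0 : p != 0 := irredp_neq0 irr_p.
have [|n [u [npu eu]]] := IH b _ b0.
  move: sa; rewrite eb size_mul // => sa; case: (irr_p) => sp _.
  rewrite -size_poly_gt0 in b0; move: (size p) (size b) sp b0 sa => i j; lia.
by exists n.+1, u; split=> //; rewrite eb eu exprS; ring.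
Qed.

Lemma irredp_inv_mod y : ~~ (p %| y) -> exists y', p %| y * y' - 1.
Proof.
move=> npy; have /Bezout_eq1_coprimepP[[s t] /= e] : coprimep p y.
  by rewrite irreducible_poly_coprime.
exists t; rewrite (_ : _ - 1 = p * - s); first exact: dvdp_mulr (dvdpp _).
by rewrite -e; ring.
Qed.

Lemma square_mod_div u x y :
  ~~ (p %| y) -> p %| x ^+ 2 - u * y ^+ 2 -> square_mod p u.
Proof.
move=> npy /dvdpP[q eq]; have [y' /dvdpP[r er]] := irredp_inv_mod npy.
exists (x * y'); apply/dvdpP; exists (- q * y' ^+ 2 - u * r * (y * y' + 1)).
transitivity (- (q * p) * y' ^+ 2 - u * (r * p) * (y * y' + 1)); last by ring.
by rewrite -eq -er; ring.
Qed.

Lemma square_modM u v : square_mod p u -> square_mod p v -> square_mod p (u * v).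
Proof.
move=> [s /dvdpP[q eq]] [t /dvdpP[r er]]; exists (s * t).
apply/dvdpP; exists (q * v + s ^+ 2 * r).
transitivity ((q * p) * v + s ^+ 2 * (r * p)); last by ring.
by rewrite -eq -er; ring.
Qed.

Lemma square_mod_sq s : square_mod p (s ^+ 2).
Proof. by exists s; rewrite subrr dvdp0. Qed.

Lemma square_mod_mulsq u s : ~~ (p %| s) -> square_mod p (u * s ^+ 2) -> square_mod p u.
Proof.
move=> nps [t pt]; apply: (@square_mod_div _ t s) => //.
by rewrite -dvdpNr opprB.
Qed.

End PrimeDecomposition.

(** * Tame residues of split symbols *)

Section TameSymbol.
Variables (F : fieldType) (p : {poly F}).
Hypothesis irr_p : irreducible_poly p.
Implicit Types (a b c d u v x y z s : {poly F}) (e f : bool).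

Let p0 : p != 0 := irredp_neq0 irr_p.

Lemma square_mod_comb u v w s : ~~ (p %| s) -> u * v = w * s ^+ 2 ->
  square_mod p u -> square_mod p v -> square_mod p w.
Proof.
by move=> nps e su sv; apply: (square_mod_mulsq irr_p nps); rewrite -e; apply: square_modM.
Qed.

Lemma qsplit_primitive u v : qsplit u v ->
  exists x y z, [|| ~~ (p %| x), ~~ (p %| y) | ~~ (p %| z)] /\
    x ^+ 2 = u * y ^+ 2 + v * z ^+ 2.
Proof.
have p1 : (1 < size p)%N by case: irr_p.
have lt_size (q : {poly F}) : q != 0 -> (size q < size (q * p)%R)%N.
  move=> q0; rewrite size_mul //; move: q0 p1; rewrite -size_poly_gt0.
  by move: (size q) (size p) => i j; lia.
have le_size (q : {poly F}) : (size q <= size (q * p)%R)%N.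
  by have [->|/lt_size/ltnW//] := eqVneq q 0; rewrite mul0r.
move=> [x [y [z [nz e]]]].
have [m] := ubnP (size x + size y + size z); elim: m x y z nz e => // m IH x y z nz e sm.
case: (boolP (p %| x)) => [/dvdpP[x' ex]|npx]; last by exists x, y, z; rewrite npx.
case: (boolP (p %| y)) => [/dvdpP[y' ey]|npy]; last by exists x, y, z; rewrite npy orbT.
case: (boolP (p %| z)) => [/dvdpP[z' ez]|npz]; last by exists x, y, z; rewrite npz !orbT.
apply: (IH x' y' z').
- by move: nz; rewrite ex ey ez !mulf_eq0 (negPf p0) !orbF.
- apply: (mulIf (expf_neq0 2 p0)); rewrite -exprMn -ex e ey ez; ring.
- move: nz sm; rewrite ex ey ez !mulf_eq0 (negPf p0) !orbF.
  have := (le_size x', le_size y', le_size z'); case=> [[lx ly] lz].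
  case/or3P=> /lt_size; move: (size x') (size y') (size z') (size (x' * p)) (size (y' * p)) (size (z' * p)) lx ly lz; lia.
Qed.

(** If p divided [y] in a primitive solution, it would divide [x], so p^2 would divide p v z^2 and p
    would divide [z] as well. Hence [y] is invertible mod p and [u] is the square of x / y. *)
Lemma qsplit_unit_odd u v : ~~ (p %| v) -> qsplit u (p * v) -> square_mod p u.
Proof.
move=> npv /qsplit_primitive[x [y [z [prim e]]]].
have e' : x ^+ 2 - u * y ^+ 2 = v * z ^+ 2 * p by rewrite e; ring.
have pd : p %| x ^+ 2 - u * y ^+ 2 by rewrite e' dvdp_mull.
have [/dvdpP[y' ey]|npy] := boolP (p %| y); last exact: square_mod_div npy pd.
have /dvdpP[x' ex] : p %| x.
  by apply/(irredp_dvdX irr_p (n := 2)); rewrite -(subrK (u * y ^+ 2) (x ^+ 2)) dvdp_add // ey dvdp_mull // expr2 dvdp_mull // dvdp_mull.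
case/negP: (npv); move: prim; rewrite ex ey !dvdp_mulIr /= => npz.
have : p %| v * z ^+ 2.
  apply/dvdpP; exists (x' ^+ 2 - u * y' ^+ 2); apply: (mulIf p0).
  by rewrite -e' ex ey; ring.
by case/(irredp_Euclid irr_p)/orP=> // /(irredp_dvdX irr_p); rewrite (negPf npz).
Qed.

(** Here p divides [x], so one factor p cancels; if p divided [z] it would also divide [y], against
    primitivity. *)
Lemma qsplit_odd_odd u v : ~~ (p %| u) -> qsplit (p * u) (p * v) ->
  exists y z, ~~ (p %| z) /\ p %| u * y ^+ 2 + v * z ^+ 2.
Proof.
move=> npu /qsplit_primitive[x [y [z [prim e]]]].
have e' : x ^+ 2 = (u * y ^+ 2 + v * z ^+ 2) * p by rewrite e; ring.
have /dvdpP[x' ex] : p %| x by apply: (irredp_dvdX irr_p (n := 2)); rewrite e' dvdp_mull.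
have e2 : u * y ^+ 2 + v * z ^+ 2 = x' ^+ 2 * p.
  by apply: (mulIf p0); rewrite -e' ex; ring.
exists y, z; rewrite e2 dvdp_mull //; split=> //; apply/negP=> pz.
have : p %| u * y ^+ 2.
  by rewrite -[_ * _](addrK (v * z ^+ 2)) e2 dvdp_sub ?dvdp_mull // expr2 dvdp_mull.
case/(irredp_Euclid irr_p)/orP; first by rewrite (negPf npu).
move/(irredp_dvdX irr_p)=> py; by move: prim; rewrite ex dvdp_mulIr py pz.
Qed.

(* e is the parity of the p-adic valuation, u the unit part. *)
Definition prime_part a e u : Prop :=
  ~~ (p %| u) /\ exists n, a = p ^+ e * u * (p ^+ n) ^+ 2.

Lemma prime_part_ex a : a != 0 -> exists e u, prime_part a e u.
Proof.
case/(irredp_decomp irr_p)=> n [u [npu ->]]; exists (odd n), u; split=> //.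
exists n./2; rewrite -{1}(odd_double_half n) exprD -mul2n mulnC exprM; ring.
Qed.

Lemma prime_partM a b e f u v : prime_part a e u -> prime_part b f v ->
  prime_part (a * b) (e (+) f) (u * v).
Proof.
move=> [npu [n ->]] [npv [l ->]]; split; first exact: irredp_ndvdM.
exists (n + l + (e && f))%N; rewrite !exprD.
by case: e f => [] [] /=; rewrite ?expr1 ?expr0; ring.
Qed.

Lemma qsplit_prime_part a b e f u v : prime_part a e u -> prime_part b f v ->
  qsplit a b -> qsplit (p ^+ e * u) (p ^+ f * v).
Proof.
move=> [npu [n ->]] [npv [l ->]] [x [y [z [nz eq]]]].
exists x, (p ^+ n * y), (p ^+ l * z); rewrite eq; split; last by ring.
by rewrite !mulf_eq0 !expf_eq0 (negPf p0) !andbF.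
Qed.

(** The tame symbol is (-1)^(v(a)v(b)) a^v(b) / b^v(a) mod p; up to sign and squares only the
    parities of the valuations and the unit parts enter. *)
Definition tame_trivial a b : Prop := forall e f u v,
  prime_part a e u -> prime_part b f v -> square_mod p (u ^+ f * v ^+ e).

Lemma tame_trivialC a b : tame_trivial a b -> tame_trivial b a.
Proof. by move=> t e f u v pa pb; rewrite mulrC; apply: t. Qed.

(* The hypothesis removes the sign (-1)^(v(a)v(b)) of the tame symbol. *)
Lemma qsplit_tame ii a b : ii ^+ 2 = - 1 :> {poly F} -> qsplit a b -> tame_trivial a b.
Proof.
move=> i2 ab e f u v pa pb; have := qsplit_prime_part pa pb ab.
case: (pa) (pb) => npu _ [npv _]; case: e f {pa pb} => [] []; rewrite ?expr0 ?expr1 ?mul1r ?mulr1.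
- case/(qsplit_odd_odd npu)=> y [z [npz d]].
  apply: (@square_mod_div _ _ irr_p _ (ii * u * y) z) => //.
  by rewrite !exprMn i2 (_ : _ - _ = - u * (u * y ^+ 2 + v * z ^+ 2)) ?dvdp_mull //; ring.
- by move/qsplitC; apply: qsplit_unit_odd.
- exact: qsplit_unit_odd.
- by move=> _; rewrite -(expr1n _ 2); apply: square_mod_sq.
Qed.

Lemma tame_trivial_cancel a b c : b != 0 ->
  tame_trivial a b -> tame_trivial a (b * c) -> tame_trivial a c.
Proof.
move=> /prime_part_ex[g [w pb]] tb tbc e f u v pa pc.
have := tb _ _ _ _ pa pb; have := tbc _ _ _ _ pa (prime_partM pb pc).
case: (pa) (pb) => npu _ [npw _].
(* As g + (g xor f) = f + 2 (g and not f), the product of the two known square classes is the wanted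
   one times the square of this element. *)
have nps : ~~ (p %| u ^+ (g && ~~ f) * w ^+ e).
  by apply: irredp_ndvdM => //; [case: (_ && _) | case: (e)];
    rewrite ?expr1 ?expr0 ?(irredp_ndvd1 irr_p).
by apply: square_mod_comb nps _; case: (e) (f) (g) => [] [] [] /=; ring.
Qed.

(* Where a, b or ab is locally a square, one of the relations gives (a, c) = 0;
   otherwise (a, b) = 0 makes a and b units and (b, c) = 0 makes v(c) even. *)
Lemma tame_trivial_chain a b c d : a != 0 -> b != 0 -> c != 0 -> d != 0 ->
  tame_trivial a b -> tame_trivial b c -> tame_trivial a d ->
  tame_trivial (a * b) (c * d) -> tame_trivial a c.
Proof.
move=> a0 /prime_part_ex[eb [ub pb]] c0 /prime_part_ex[ed [ud pd]] tab tbc tad tabcd.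
move=> ea ec ua uc pa pc.
have := tab _ _ _ _ pa pb; have := tbc _ _ _ _ pb pc; have := tad _ _ _ _ pa pd.
have := tabcd _ _ _ _ (prime_partM pa pb) (prime_partM pc pd).
case: pa pb pc pd => na _ [nb _] [nc _] [nd _].
have n1 := irredp_ndvd1 irr_p.
have ndM := irredp_ndvdM irr_p.
have s1 : square_mod p 1 by rewrite -(expr1n _ 2); apply: square_mod_sq.
have comb := square_mod_comb.
case: ea eb ec ed => [] [] [] [] /=; rewrite ?expr0 ?expr1 ?mul1r ?mulr1 // => h4 h3 h2 h1 //.
- by apply: comb nb _ h1 h2; ring.
- by apply: comb nb _ h1 h2; ring.
- by apply: comb nd _ h4 h3; ring.
- have h5 : square_mod p (ua * ub * uc) by apply: comb nd _ h4 h3; ring.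
  by apply: comb nb _ h5 h1; ring.
- have h5 : square_mod p (ub * uc) by apply: comb (ndM _ _ na nd) _ h4 h3; ring.
  by apply: comb nb _ h5 h1; ring.
- by apply: comb nd _ h4 h3; ring.
- by apply: comb nb _ h4 h2; ring.
Qed.
End TameSymbol.

Section SquareModSquarefree.
Variable F : fieldType.
Implicit Types a c p q r s : {poly F}.

Lemma irredp_factor c : (1 < size c)%N -> exists p, irreducible_poly p /\ p %| c.
Proof.
have [m] := ubnP (size c); elim: m c => // m IH c sc c1.
have c0 : c != 0 by rewrite -size_poly_gt0 ltnW.
have [irr|red] := pselect (irreducible_poly c); first by exists c.
have [q [q1 [qc nqc]]] : exists q, size q != 1 /\ q %| c /\ ~~ (q %= c).
  apply: contrapT => none; apply: red; split=> // q q1 qc.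
  by apply/negPn/negP => nqc; apply: none; exists q.
have q0 : q != 0 by apply: contraNneq c0 => q0; rewrite q0 dvd0p in qc.
have sq : (size q < size c)%N.
  by rewrite ltn_neqAle dvdp_leq // andbT; apply: contra nqc; rewrite dvdp_size_eqp.
have [||p [irr pq]] := IH q; first exact: leq_trans sq _.
  by move: q0 q1; rewrite -size_poly_gt0; case: (size q) => [|[]].
by exists p; split=> //; apply: dvdp_trans pq qc.
Qed.

(** Chinese remainder theorem, one irreducible factor at a time; squarefreeness makes the factor
    coprime to its cofactor. *)
Lemma square_mod_squarefree a c : c != 0 ->
  (forall q, (1 < size q)%N -> ~~ (q ^+ 2 %| c)) ->
  (forall p, irreducible_poly p -> p %| c -> square_mod p a) ->
  square_mod c a.
Proof.
have [m] := ubnP (size c); elim: m c => // m IH c sc c0 sqf sqm.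
have [c1|c1] := leqP (size c) 1.
  exists 0; apply: dvdUp; rewrite -size_poly_eq1 eqn_leq c1.
  by rewrite size_poly_gt0.
have [p [irr /dvdpP[c' ec]]] := irredp_factor c1.
have p0 := irredp_neq0 irr; have [sp _] := irr.
have c'0 : c' != 0 by apply: contraNneq c0 => e; rewrite ec e mul0r.
have [|||s2 d2] := IH c' _ c'0.
- move: sc; rewrite ec size_mul //; move: c'0; rewrite -size_poly_gt0.
  by move: (size p) (size c') sp => i j; lia.
- by move=> q /sqf; apply: contra => d; rewrite ec dvdp_mulr.
- by move=> q irrq d; apply: sqm => //; rewrite ec dvdp_mulr.
have [s1 d1] : square_mod p a by apply: sqm; rewrite // ec dvdp_mull.
have cop : coprimep p c'.
  rewrite irreducible_poly_coprime //; apply: contra (sqf p sp) => /dvdpP[r er].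
  by rewrite ec er expr2 -mulrA dvdp_mull.
have /Bezout_eq1_coprimepP[[s t] /= bez] := cop.
(* Bezout idempotents: this is [s1] modulo [p] and [s2] modulo [c']. *)
exists (s1 * (t * c') + s2 * (s * p)); rewrite ec mulrC Gauss_dvdp //.
have e1 : t * c' = 1 - s * p by rewrite -bez; ring.
apply/andP; split.
  rewrite e1 (_ : _ - _ = (a - s1 ^+ 2) - s * ((s2 - s1) * (s1 *+ 2 + (s2 - s1) * (s * p))) * p); last by ring.
  by rewrite dvdp_sub // dvdp_mull.
have e2 : s * p = 1 - t * c' by rewrite -bez; ring.
rewrite e2 (_ : _ - _ = (a - s2 ^+ 2) - t * ((s1 - s2) * (s2 *+ 2 + (s1 - s2) * (t * c'))) * c'); last by ring.
by rewrite dvdp_sub // dvdp_mull.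
Qed.

End SquareModSquarefree.

(** * Specialisation of symbols at a point of the affine line *)

Section Specialization.
Variable F : fieldType.
Implicit Types (a b c p q U V : {poly F}) (x y u v w : F).

Lemma prime_part_inj p a (e f : bool) U V : irreducible_poly p ->
  prime_part p a e U -> prime_part p a f V -> U = V.
Proof.
move=> irr [npU [n ->]] [npV [l]]; have p0 := irredp_neq0 irr.
have key : forall (i j : nat) A B, ~~ (p %| B) -> (i <= j)%N -> ~~ (p %| A) ->
    p ^+ i * A = p ^+ j * B -> A = B.
  move=> i j A B _ /subnKC <- npA; rewrite exprD -mulrA => /(mulfI (expf_neq0 i p0)) eA.
  move: npA; rewrite eA; case: (j - i)%N => [|k]; first by rewrite expr0 mul1r.
  by rewrite exprS -mulrA dvdp_mulIl.
rewrite -!exprM (_ : p ^+ e * U * _ = p ^+ (e + n * 2) * U); last by rewrite exprD; ring.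
rewrite (_ : p ^+ f * V * _ = p ^+ (f + l * 2) * V); last by rewrite exprD; ring.
move=> eq; case: (leqP (e + n * 2) (f + l * 2)) => [le|/ltnW le]; first exact: key npV le npU eq.
by symmetry; apply: key npU le npV (esym eq).
Qed.

(* u is the lowest coefficient of a at x, i.e. a specialises to u at X = x
   once the uniformizer X - x is sent to 1. *)
Definition lowest_coef x a u : Prop :=
  exists e U, prime_part ('X - x%:P) a e U /\ U.[x] = u.

Let irrX x := irredp_XsubC x.

Lemma lowest_coef_ex x a : a != 0 -> exists u, lowest_coef x a u.
Proof. by case/(prime_part_ex (irrX x))=> e [U pU]; exists U.[x], e, U. Qed.

Lemma lowest_coef_inj x a u v : lowest_coef x a u -> lowest_coef x a v -> u = v.
Proof. by move=> [e [U [pU <-]]] [f [V [pV <-]]]; rewrite (prime_part_inj (irrX x) pU pV). Qed.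

Lemma lowest_coefM x a b u v :
  lowest_coef x a u -> lowest_coef x b v -> lowest_coef x (a * b) (u * v).
Proof.
move=> [e [U [pU <-]]] [f [V [pV <-]]].
by exists (e (+) f), (U * V); rewrite hornerM; split=> //; apply: (prime_partM (irrX x)).
Qed.

Lemma lowest_coef_neq0 x a u : lowest_coef x a u -> u != 0.
Proof. by move=> [e [U [[npU _] <-]]]; rewrite -rootE root_factor_theorem. Qed.

Lemma lowest_coef_horner x a : a.[x] != 0 -> lowest_coef x a a.[x].
Proof.
move=> ax; exists false, a; split=> //; split; first by rewrite dvdp_XsubCl.
by exists 0; rewrite !expr0 expr1n mulr1 mul1r.
Qed.

(** Strip even powers of X - x. If exactly one entry is odd, the other specialises to a square; if
    both are odd, the specialised conic has a point with first coordinate 0; if none is, a primitive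
    solution can be evaluated at x. *)
Lemma qsplit_lowest_coef x a b u v : qsplit a b ->
  lowest_coef x a u -> lowest_coef x b v -> qsplit u v.
Proof.
move=> ab [e [U [pU <-]]] [f [V [pV <-]]]; have := qsplit_prime_part (irrX x) pU pV ab.
have sq_root q : square_mod ('X - x%:P) q -> exists s, q.[x] = s ^+ 2.
  case=> s; rewrite dvdp_XsubCl rootE !hornerE subr_eq0 => /eqP->.
  by exists s.[x]; rewrite ?hornerE.
case: pU pV => npU _ [npV _].
case: e f => [] []; rewrite ?expr0 ?expr1 ?mul1r ?mulr1.
- case/(qsplit_odd_odd (irrX x) npU)=> y [z [npz]]; rewrite dvdp_XsubCl in npz.
  rewrite dvdp_XsubCl rootE !hornerE => /eqP eq.
  exists 0, y.[x], z.[x]; rewrite -rootE npz !orbT; split=> //.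
  by rewrite expr0n /=; transitivity (U.[x] * y.[x] * y.[x] + V.[x] * z.[x] * z.[x]); [symmetry|ring].
- move/qsplitC/(qsplit_unit_odd (irrX x) npU)/sq_root=> [s ->].
  exact/qsplitC/qsplit_sq.
- by move/(qsplit_unit_odd (irrX x) npV)/sq_root=> [s ->]; apply: qsplit_sq.
case/(qsplit_primitive (irrX x))=> y [z [t [nz eq]]].
exists y.[x], z.[x], t.[x]; rewrite !dvdp_XsubCl !rootE in nz; split=> //.
by move/(congr1 (horner^~ x)): eq; rewrite !hornerE.
Qed.

End Specialization.

(** * Legendre's descent for conics over F[X] *)

Section LegendreDescent.
Variables (F : fieldType) (ii : F).
Hypothesis ii2 : ii ^+ 2 = - 1.
Implicit Types (a b c d p q s : {poly F}) (x y u v w : F).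

Let iiP : (ii%:P) ^+ 2 = - 1 :> {poly F}.
Proof. by rewrite -rmorphXn /= ii2 rmorphN1. Qed.

Lemma lowest_coef_const x a u : (size a <= 1)%N -> lowest_coef x a u -> u = a`_0.
Proof.
move=> /size1_polyC-> lu; apply: (lowest_coef_inj lu).
have [a0|a0] := eqVneq a`_0 0.
  case: lu => [e [U [[npU [n /eqP e0]] _]]]; move: e0.
  rewrite a0 eq_sym !mulf_eq0 !expf_eq0 polyXsubC_eq0 !andbF !orbF /= => /eqP U0.
  by rewrite U0 dvdp0 in npU.
by rewrite coefC eqxx -{2}[a`_0](hornerC a`_0 x); apply: lowest_coef_horner; rewrite hornerC.
Qed.

(** At a prime factor of c not dividing a, c has odd valuation, so the trivial residue makes a a
    square there. A root modulo c is then reduced below the degree of c, and a - s^2 has degree at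
    most max(deg a, 2 deg c - 2) < 2 deg c. *)
Lemma legendre_step a c : a != 0 -> c != 0 ->
  (forall p, irreducible_poly p -> tame_trivial p a c) ->
  (size a <= size c)%N -> (1 < size c)%N ->
  (forall q, (1 < size q)%N -> ~~ (q ^+ 2 %| c)) ->
  exists s q, a = s ^+ 2 + c * q /\ (size q < size c)%N.
Proof.
move=> a0 c0 tame ac c1 sqf.
have [p irr pc|s /dvdpP[q eq]] := square_mod_squarefree (a := a) c0 sqf.
  have [pa|npa] := boolP (p %| a); first by exists 0; rewrite expr0n /= subr0.
  have pa : prime_part p a false a.
    by split=> //; exists 0; rewrite !expr0 expr1n mulr1 mul1r.
  have [e [u pcu]] := prime_part_ex irr c0.
  have := tame p irr _ _ _ _ pa pcu; rewrite expr0 mulr1; case: e pcu => [|[npu [n ec]]].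
    by rewrite expr1.
  move=> _; exfalso; move: (sqf (p ^+ n)) pc npu; rewrite ec expr0 mul1r.
  case: n ec => [|n] ec; first by rewrite expr0 expr1n mulr1 => _ ->.
  move=> /(_ _)/negP[]; last exact: dvdp_mulIr.
  rewrite -(ltn_predK (_ : 0 < size (p ^+ n.+1)))%N; last first.
    by rewrite size_poly_gt0 expf_neq0 // irredp_neq0.
  rewrite ltnS size_exp; case: irr => sp _.
  by rewrite muln_gt0 andbT; case: (size p) sp => [|[]].
pose r := s %% c; have sr : (size r < size c)%N by rewrite ltn_modp.
have /dvdpP[q' eq'] : c %| a - r ^+ 2.
  have sr' : s - r = s %/ c * c by rewrite {1}(divp_eq s c) addrK.
  rewrite (_ : _ - _ = (a - s ^+ 2) + (s - r) * (s + r)); last by ring.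
  by rewrite sr' eq -mulrA (mulrC c) mulrA dvdp_add ?dvdp_mull.
exists r, q'; split; first by rewrite mulrC -eq'; ring.
have [->|q'0] := eqVneq q' 0; first by rewrite size_poly0 ltnW.
have := size_polyD a (- r ^+ 2); rewrite eq' size_mul // size_polyN.
have : (size (r ^+ 2)).-1 = ((size r).-1 * 2)%N by rewrite size_exp.
move: sr c1 ac q'0; rewrite -[q' == 0]size_poly_eq0.
move: (size q') (size c) (size a) (size r) (size (r ^+ 2)) => i j l m n; lia.
Qed.

(* Legendre's descent: writing a = s^2 + c q with c squarefree replaces (a, c)
   by (a, q) without changing the class, until both entries are constant. *)
Lemma tame_constant a c : a != 0 -> c != 0 ->
  (forall p, irreducible_poly p -> tame_trivial p a c) ->
  forall x y u w u' w', lowest_coef x a u -> lowest_coef x c w ->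
    lowest_coef y a u' -> lowest_coef y c w' -> qsplit u w -> qsplit u' w'.
Proof.
have [m] := ubnP (size a + size c); elim: m a c => // m IH a c sm a0 c0 tame.
move=> x y u w u' w'.
wlog ac : a c sm a0 c0 tame u w u' w' / (size a <= size c)%N.
  move=> wl lxa lxc lya lyc uw; have [ac|/ltnW ca] := leqP (size a) (size c).
    exact: wl ac lxa lxc lya lyc uw.
  apply/qsplitC; apply: (wl _ _ _ c0 a0 _ _ _ _ _ ca lxc lxa lyc lya); last exact: qsplitC.
    by rewrite addnC.
  by move=> p irr; apply/tame_trivialC/tame.
move=> lxa lxc lya lyc uw.
have [c1|c1] := leqP (size c) 1.
  have a1 := leq_trans ac c1.
  by rewrite (lowest_coef_const a1 lya) (lowest_coef_const c1 lyc)
    -(lowest_coef_const a1 lxa) -(lowest_coef_const c1 lxc).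
have [sqf|] := pselect (forall q, (1 < size q)%N -> ~~ (q ^+ 2 %| c)).
  have [s [q [ea sq]]] := legendre_step a0 c0 tame ac c1 sqf.
  have [q0|q0] := eqVneq q 0.
    have s0 : s != 0 by apply: contraNneq a0 => s0; rewrite ea q0 s0 expr0n mulr0 addr0.
    have [r lr] := lowest_coef_ex y s0.
    rewrite (lowest_coef_inj lya (_ : lowest_coef y a (r ^+ 2))); first exact: qsplit_sq.
    by rewrite ea q0 mulr0 addr0; apply: lowest_coefM.
  (* The norm s^2 - a equals - c q, and -1 is a square. *)
  have acq : qsplit a (c * q).
    apply: (@qsplitC _ (c * q) a).
    exists s, ii%:P, 1; rewrite oner_neq0 !orbT; split=> //.
    by rewrite iiP ea; ring.
  have [v lxq] := lowest_coef_ex x q0; have [v' lyq] := lowest_coef_ex y q0.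
  have w0 := lowest_coef_neq0 lxc; have w'0 := lowest_coef_neq0 lyc.
  have v0 := lowest_coef_neq0 lxq; have v'0 := lowest_coef_neq0 lyq.
  have s1 : qsplit u (w * v) by apply: qsplit_lowest_coef acq lxa (lowest_coefM lxc lxq).
  have s2 : qsplit u' (w' * v') by apply: qsplit_lowest_coef acq lya (lowest_coefM lyc lyq).
  have uv : qsplit u v by apply/(qsplit_mulr w0 v0 uw).
  have u'v' : qsplit u' v'.
    apply: IH lxa lxq lya lyq uv => //.
      by move: sm sq; move: (size a) (size c) (size q) => i j l; lia.
    move=> p irr; apply: (tame_trivial_cancel irr c0 (tame p irr)).
    exact: qsplit_tame iiP acq.
  by rewrite mulrC in s2; apply/(qsplit_mulr v'0 w'0 u'v').
(* A square factor of c affects neither the residues nor the splitting of the specialised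
   symbols. *)
move=> /existsNP[q /not_implyP[q1 /negP/negPn/dvdpP[c' ec]]].
have c'0 : c' != 0 by apply: contraNneq c0 => e; rewrite ec e mul0r.
have q0 : q != 0 by rewrite -size_poly_gt0 ltnW.
have [r lxq] := lowest_coef_ex x q0; have [r' lyq] := lowest_coef_ex y q0.
have [v lxc'] := lowest_coef_ex x c'0; have [v' lyc'] := lowest_coef_ex y c'0.
have r0 := lowest_coef_neq0 lxq; have r'0 := lowest_coef_neq0 lyq.
have ew : w = v * r ^+ 2.
  by apply: (lowest_coef_inj lxc); rewrite ec; do 2?apply: lowest_coefM.
have ew' : w' = v' * r' ^+ 2.
  by apply: (lowest_coef_inj lyc); rewrite ec; do 2?apply: lowest_coefM.
rewrite ew' qsplit_mulsq //; rewrite ew qsplit_mulsq // in uw.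
apply: IH lxa lxc' lya lyc' uw => //.
  move: sm; rewrite ec size_mul ?expf_neq0 //.
  have : (size (q ^+ 2)).-1 = ((size q).-1 * 2)%N by rewrite size_exp.
  by move: q1 c'0; rewrite -size_poly_gt0; move: (size a) (size c') (size q) (size (q ^+ 2)) => i j l n; lia.
move=> p irr; apply: (@tame_trivial_cancel _ _ irr _ (q ^+ 2)); first by rewrite expf_neq0.
  by apply: (qsplit_tame irr iiP); apply/qsplitC/qsplit_sq.
by rewrite mulrC -ec; apply: tame.
Qed.

(** The relations kill the residues of (a, c), and at 1 the symbol splits because a is a square
    there; constancy carries the splitting to 0. The entries b and d may vanish at 0 or 1. *)
Theorem qsplit_line a b c d v :
  [/\ qsplit a b, qsplit b c, qsplit a d & qsplit (a * b) (c * d)] ->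
  b != 0 -> d != 0 -> a.[0] != 0 -> c.[0] != 0 -> a.[1] != 0 -> c.[1] != 0 ->
  a.[1] = v ^+ 2 -> qsplit a.[0] c.[0].
Proof.
move=> [ab bc ad abcd] b0 d0 a_0 c_0 a_1 c_1 ev.
have a0 : a != 0 by apply: contraNneq a_0 => ->; rewrite horner0.
have c0 : c != 0 by apply: contraNneq c_0 => ->; rewrite horner0.
apply: (@tame_constant a c a0 c0 _ 1 0 a.[1] c.[1]);
  try exact: lowest_coef_horner; last by rewrite ev; apply: qsplit_sq.
move=> p irr; have tame := qsplit_tame irr iiP.
exact: (tame_trivial_chain irr a0 b0 c0 d0 (tame _ _ ab) (tame _ _ bc) (tame _ _ ad) (tame _ _ abcd)).
Qed.

End LegendreDescent.

(** * Square roots, and points where a polynomial does not vanish *)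

Section FieldPreliminaries.

Lemma adjoin_sqrt (F : fieldType) (x : F) :
  exists (L : fieldType) (j : {rmorphism F -> L}) (y : L), y ^+ 2 = j x.
Proof.
have [[y <-]|nsq] := pselect (exists y, y ^+ 2 = x); first by exists F, idfun, y.
have irr : irreducible_poly ('X^2 - x%:P).
  apply: cubic_irreducible; first by rewrite size_XnsubC.
  move=> y; apply/negP; rewrite rootE !hornerE subr_eq0 => /eqP e.
  by apply: nsq; exists y; rewrite -e.
have [L _ [z rz _]] := irredp_FAdjoin irr.
exists L, (in_alg L : {rmorphism F -> L}), z; apply/eqP; rewrite -subr_eq0.
by move: rz; rewrite rootE rmorphB /= map_polyXn map_polyC !hornerE.
Qed.

Lemma infinite_nonroot (F : fieldType) (p : {poly F}) :
  infinite_set [set: F]%classic -> p != 0 -> exists x, p.[x] != 0.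
Proof.
move=> infF p0; apply: contrapT => none.
have [X _ sX] := infinite_set_fset (size p) infF.
have lt : (size (enum_fset X) < size p)%N.
  apply: max_poly_roots => //; last exact: fset_uniq.
  by apply/allP=> x _; apply/negPn/negP => nr; apply: none; exists x.
by have := leq_trans lt sX; rewrite ltnn.
Qed.

Lemma rmorph_mpoly (n : nat) (R : comNzRingType) (S : comNzRingType)
    (g : {rmorphism {mpoly R[n]} -> S}) p :
  g p = mmap (g \o @mpolyC n R) (fun i => g 'X_i) p.
Proof.
rewrite [in LHS](mpolyE p) rmorph_sum /=; apply: eq_bigr => m _.
rewrite -mul_mpolyC rmorphM; congr (_ * _).
by rewrite mpolyXE_id rmorph_prod; apply: eq_bigr => i _; rewrite rmorphXn.
Qed.

(** Each monomial of [p] contributes to exactly one coefficient of [muni p], so its coefficient can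
    be read off there. *)
Lemma muni_inj0 (n : nat) (R : comNzRingType) (p : {mpoly R[n.+1]}) : muni p = 0 -> p = 0.
Proof.
move=> e; apply/mpolyP=> m; rewrite mcoeff0.
have [|/memN_msupp_eq0//] := boolP (m \in msupp p) => mp.
have : ((muni p)`_(m ord_max))@_[multinom (m (widen_ord (leqnSn n) i)) | i < n] = 0.
  by rewrite e coef0 mcoeff0.
rewrite muniE coef_sum raddf_sum /= (bigD1_seq m) //= big1 ?addr0 => [|m' ne].
  by rewrite coefZ coefXn eqxx mulr1 mcoeffZ mcoeffX eqxx mulr1.
rewrite coefZ coefXn mulr_natr mcoeffMn mcoeffZ mcoeffX.
case: eqP => [e1|]; last by rewrite mulr0 mul0rn.
case: eqP => [e2|]; last by rewrite mulr0n.
case/eqP: ne; apply/mnmP=> i; have [->|ni] := eqVneq i ord_max; first by [].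
have li : (i < n)%N by have := ltn_ord i; rewrite ltnS leq_eqVlt -val_eqE /= in ni * => /orP[/eqP E|//]; rewrite E eqxx in ni.
move/mnmP/(_ (Ordinal li)): e1; rewrite !mnmE.
by rewrite (_ : widen_ord _ _ = i) //; apply: val_inj.
Qed.

Lemma mpoly_nonvanishing (F : fieldType) (n : nat) (p : {mpoly F[n]}) :
  infinite_set [set: F]%classic -> p != 0 -> exists v, p.@[v] != 0.
Proof.
move=> infF; elim: n p => [|n IH] p p0.
  exists (fun=> 0); apply: contraNneq p0 => e.
  have pC : p = (p@_0%MM)%:MP.
    apply/mpolyP=> m; rewrite mcoeffC (_ : m = 0%MM) ?eqxx ?mulr1 //.
    by apply/mnmP=> -[].
  by rewrite pC mevalC in e; rewrite pC e.
have [j cj] : exists j, (muni p)`_j != 0.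
  exists (size (muni p)).-1; rewrite -lead_coefE lead_coef_eq0.
  by apply: contraNneq p0 => /muni_inj0->.
have [v vj] := IH _ cj.
have [x px] : exists x, (map_poly (meval v) (muni p)).[x] != 0.
  apply: infinite_nonroot => //; apply: contraNneq vj => e.
  by rewrite -coef_map /= e coef0.
(* Evaluates the last variable at [x] and the others at [v]; the required point consists of the
   images of the variables. *)
pose g := (horner_eval x \o map_poly (meval v) \o @muni n F) : {rmorphism {mpoly F[n.+1]} -> F}.
exists (fun i => g 'X_i); have := rmorph_mpoly g p.
rewrite (_ : g p = (map_poly (meval v) (muni p)).[x]) // => e; move: px; rewrite e.
rewrite /meval (_ : mmap (g \o _) _ p = mmap idfun (fun i => g 'X_i) p) //.
apply: eq_bigr => m _; congr (_ * _); rewrite /= /g /= muniC /horner_eval map_polyC hornerC.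
exact: mevalC.
Qed.

End FieldPreliminaries.

(** * Fraction fields and their morphisms *)

Section Fractions.

Lemma fracP (D : idomainType) (z : {fraction D}) :
  exists p q, q != 0 /\ z = tofrac p / tofrac q.
Proof.
elim/quotW: z => r; exists (fraction.frac r).1, (fraction.frac r).2.
have d0 := denom_ratioP r; split=> //.
apply: (canRL (mulfK _)); first by rewrite tofrac_eq0.
change (FracField.mul (\pi r)%qT (tofrac (fraction.frac r).2) = tofrac (fraction.frac r).1).
apply/eqP; rewrite !piE /FracField.equivf /FracField.mulf !numden_Ratio ?mulf_neq0 ?oner_eq0 //.
by rewrite mulr1 mulr1 mulrC.
Qed.

Lemma frac_lift (D : idomainType) (N : fieldType) (e : {rmorphism D -> N}) :
  (forall x, e x = 0 -> x = 0) ->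
  exists g : {rmorphism {fraction D} -> N}, forall x, g (tofrac x) = e x.
Proof.
move=> inj_e.
have e0 x : x != 0 -> e x != 0 by apply: contra_neq => /inj_e.
have [num Hnum] := choice (@fracP D); have [den Hden] := choice Hnum.
have den0 z : den z != 0 by case: (Hden z).
have numE z : z = tofrac (num z) / tofrac (den z) by case: (Hden z).
have F0 z : tofrac (den z) != 0 by rewrite tofrac_eq0.
pose g z := e (num z) / e (den z).
(* Independence of the chosen representative. *)
have gE p q : q != 0 -> g (tofrac p / tofrac q) = e p / e q.
  move=> q0; apply/eqP; rewrite eqr_div ?e0 // -!rmorphM; apply/eqP; congr (e _).
  apply/eqP; rewrite -tofrac_eq !tofracM.
  by rewrite -eqr_div ?tofrac_eq0 // -numE.
have gB : zmod_morphism g.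
  move=> x y; rewrite {1}(numE x) {1}(numE y) -mulNr addf_div // -tofracN -!tofracM -tofracD gE ?mulf_neq0 //.
  by rewrite rmorphD !rmorphM rmorphN /g -mulNr addf_div // e0.
have gM : monoid_morphism g.
  split=> [|x y].
    by rewrite -(divr1 1) -tofrac1 gE ?oner_neq0 // rmorph1 divr1.
  by rewrite {1}(numE x) {1}(numE y) mulf_div -!tofracM gE ?mulf_neq0 // !rmorphM /g mulf_div.
pose gz := GRing.isZmodMorphism.Build _ _ g gB.
pose gm := GRing.isMonoidMorphism.Build _ _ g gM.
pose gr : {rmorphism {fraction D} -> N} := HB.pack g gz gm.
exists gr => x; have := gE x 1; rewrite tofrac1 rmorph1 !divr1; apply; exact: oner_neq0.
Qed.

End Fractions.

(** One floor of the tower k(m)(h)(f)(R)(T). It is made opaque below, so that nested fraction fields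
    stay folded. *)
Definition FX (F : fieldType) : fieldType := {fraction {poly F}}.

Definition toFX (F : fieldType) : {rmorphism {poly F} -> FX F} :=
  (@tofrac {poly F} : {rmorphism {poly F} -> {fraction {poly F}}}).
Arguments toFX {F} : simpl never.

Definition tX {F : fieldType} : FX F := toFX 'X.

Definition fracC {F : fieldType} : {rmorphism F -> FX F} := (toFX \o @polyC F).
Arguments fracC {F} : simpl never.

(** * Semilinear substitutions X |-> r X and X |-> r / X *)

Section OneVariable.
Variable F : fieldType.
Implicit Types p q : {poly F}.

Lemma toFX0 : toFX 0 = 0 :> FX F. Proof. exact: rmorph0. Qed.
Lemma toFX1 : toFX 1 = 1 :> FX F. Proof. exact: rmorph1. Qed.
Lemma toFXD p q : toFX (p + q) = toFX p + toFX q. Proof. exact: rmorphD. Qed.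
Lemma toFXN p : toFX (- p) = - toFX p. Proof. exact: rmorphN. Qed.
Lemma toFXM p q : toFX (p * q) = toFX p * toFX q. Proof. exact: rmorphM. Qed.
Lemma toFXXn p n : toFX (p ^+ n) = toFX p ^+ n. Proof. exact: rmorphXn. Qed.
Lemma toFX_Xn n : toFX ('X ^+ n) = tX ^+ n :> FX F. Proof. exact: rmorphXn. Qed.
Lemma toFXC (a : F) : toFX a%:P = fracC a. Proof. by []. Qed.

Lemma toFX_eq p q : (toFX p == toFX q) = (p == q).
Proof. exact: tofrac_eq. Qed.

Lemma toFX_eq0 p : (toFX p == 0) = (p == 0).
Proof. exact: tofrac_eq0. Qed.

Lemma FXP (z : FX F) : exists p q, q != 0 /\ z = toFX p / toFX q.
Proof. exact: fracP. Qed.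

Lemma FX_lift (N : fieldType) (e : {rmorphism {poly F} -> N}) :
  (forall p, e p = 0 -> p = 0) ->
  exists g : {rmorphism FX F -> N}, forall p, g (toFX p) = e p.
Proof. exact: frac_lift. Qed.

Lemma tX_neq0 : (tX : FX F) != 0.
Proof. by rewrite /tX toFX_eq0 polyX_eq0. Qed.

Lemma fracX_eq (N : fieldType) (g h : {rmorphism FX F -> N}) :
  (forall a, g (fracC a) = h (fracC a)) -> g tX = h tX -> g =1 h.
Proof.
move=> eC eX; move=> z; have [p [q [q0 ->]]] := FXP z; suff e f : g (toFX f) = h (toFX f) by rewrite !fmorph_div !e.
elim/poly_ind: f => [|f c IH].
  by rewrite toFX0 !rmorph0.
by rewrite toFXD toFXM toFXC -/tX !rmorphD !rmorphM IH eX eC.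
Qed.

Definition subst_poly (s : {rmorphism F -> F}) (z : FX F) : {rmorphism {poly F} -> FX F} :=
  (horner_eval z \o map_poly (fracC \o s)).

Lemma subst_polyE s z p : subst_poly s z p = \sum_(i < size p) fracC (s p`_i) * z ^+ i.
Proof. by rewrite /= /horner_eval horner_poly. Qed.

Lemma subst_polyC s z a : subst_poly s z a%:P = fracC (s a).
Proof. by rewrite /= map_polyC /horner_eval hornerC. Qed.

Lemma subst_polyX s z : subst_poly s z 'X = z.
Proof. by rewrite /= map_polyX /horner_eval hornerX. Qed.

(* X^(deg p) times the image of p under the semilinear substitution X |-> r / X. *)
Definition recip (s : {rmorphism F -> F}) (r : F) (p : {poly F}) : {poly F} :=
  \poly_(i < size p) (s p`_((size p).-1 - i) * r ^+ ((size p).-1 - i)).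

Lemma toFX_poly n (c : nat -> F) :
  toFX (\poly_(i < n) c i) = \sum_(i < n) fracC (c i) * tX ^+ i.
Proof.
rewrite poly_def rmorph_sum; apply: eq_bigr => i _.
by rewrite /= -mul_polyC toFXM toFXXn.
Qed.

Lemma subst_recip s r p :
  subst_poly s (fracC r / tX) p * tX ^+ (size p).-1 = toFX (recip s r p).
Proof.
have key i : (i < size p)%N -> fracC (s p`_i) * (fracC r / tX) ^+ i * tX ^+ (size p).-1 =
    fracC (s p`_((size p).-1 - (size p - i.+1)) * r ^+ ((size p).-1 - (size p - i.+1)))
    * tX ^+ (size p - i.+1).
  move=> li; rewrite (_ : (size p).-1 - _ = i)%N; last by move: (size p) li => n; lia.
  have -> : tX ^+ (size p).-1 = tX ^+ i * tX ^+ (size p - i.+1) :> FX F.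
    by rewrite -exprD; congr (_ ^+ _); move: (size p) li => n; lia.
  rewrite (rmorphM fracC) (rmorphXn fracC) expr_div_n -!mulrA; congr (_ * (_ * _)).
  by rewrite mulrA mulVf ?mul1r // expf_neq0 ?tX_neq0.
rewrite /recip toFX_poly (reindex_inj rev_ord_inj) subst_polyE mulr_suml.
by apply: eq_bigr => i _; apply: key.
Qed.

Lemma recip_eq0 s r p : r != 0 -> recip s r p = 0 -> p = 0.
Proof.
move=> r0 /(congr1 (fun q : {poly F} => q`_0)); rewrite coef_poly coef0 subn0.
have [->|p0] := eqVneq p 0 => //; rewrite size_poly_gt0 p0 => /eqP.
by rewrite -lead_coefE mulf_eq0 expf_eq0 (negPf r0) andbF orbF fmorph_eq0 lead_coef_eq0 (negPf p0).
Qed.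

Lemma subst_scale s r p :
  subst_poly s (fracC r * tX) p = toFX (\poly_(i < size p) (s p`_i * r ^+ i)).
Proof.
rewrite toFX_poly subst_polyE; apply: eq_bigr => i _.
by rewrite (rmorphM fracC) (rmorphXn fracC) exprMn mulrA.
Qed.

(** The substitution is injective on polynomials, hence extends to fractions: the leading
    coefficient survives X |-> r X, and it becomes the constant term of [recip] under X |-> r /
    X. *)
Lemma fracX_aut (s : {rmorphism F -> F}) (r : F) (inv : bool) : r != 0 ->
  exists g : {rmorphism FX F -> FX F},
    (forall a, g (fracC a) = fracC (s a)) /\
    g tX = if inv then fracC r / tX else fracC r * tX.
Proof.
move=> r0; set z := if inv then _ else _.
have [p e|g gE] := FX_lift (e := subst_poly s z); last first.
  by exists g; split=> [a|]; rewrite gE ?subst_polyX ?subst_polyC.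
move: e; rewrite /z; case: inv {z} => e.
  apply: (@recip_eq0 s r) => //; apply/eqP; rewrite -toFX_eq0 -subst_recip e mul0r //.
move/eqP: e; rewrite subst_scale toFX_eq0 => /eqP e.
apply/eqP; rewrite -lead_coef_eq0 lead_coefE; move/(congr1 (fun q : {poly F} => q`_(size p).-1)): e.
rewrite coef_poly coef0; have [->|p0] := eqVneq p 0; first by rewrite coef0.
rewrite prednK ?size_poly_gt0 // leqnn => /eqP.
by rewrite mulf_eq0 expf_eq0 (negPf r0) andbF orbF fmorph_eq0.
Qed.

End OneVariable.

Section Reciprocal.
Variables (F : fieldType) (s : {rmorphism F -> F}) (r : F).
Hypothesis r0 : r != 0.
Implicit Types p q : {poly F}.
Local Notation recip := (recip s r).

(** A root at 0 would lower the degree of the reversed polynomial; powers of X are therefore split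
    off before degrees are compared. *)
Lemma size_recip p : p`_0 != 0 -> size (recip p) = size p.
Proof.
move=> p0; have sp : (0 < size p)%N.
  by rewrite size_poly_gt0; apply: contraNneq p0 => ->; rewrite coef0.
by apply: size_poly_eq; rewrite subnn expr0 mulr1 fmorph_eq0.
Qed.

Lemma recip_coef0 p : (recip p)`_0 = s (lead_coef p) * r ^+ (size p).-1.
Proof.
rewrite coef_poly subn0 -lead_coefE; case: posnP => // /eqP.
by rewrite size_poly_eq0 => /eqP->; rewrite lead_coef0 rmorph0 mul0r.
Qed.

Lemma recip_coef0_neq0 p : p != 0 -> (recip p)`_0 != 0.
Proof.
by move=> p0; rewrite recip_coef0 mulf_neq0 ?expf_neq0 // fmorph_eq0 lead_coef_eq0.
Qed.

Lemma recipM p q : p != 0 -> q != 0 -> recip (p * q) = recip p * recip q.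
Proof.
move=> p0 q0; apply/eqP; rewrite -toFX_eq toFXM -!subst_recip rmorphM size_mul //.
have -> : ((size p + size q).-1.-1 = (size p).-1 + (size q).-1)%N.
  by move: p0 q0; rewrite -!size_poly_gt0; move: (size p) (size q) => i j; lia.
by rewrite exprD mulrACA.
Qed.

Lemma recipZ a p : a != 0 -> recip (a *: p) = s a *: recip p.
Proof.
move=> a0; apply/polyP=> i; rewrite coefZ !coef_poly size_scale //.
by case: ifP => _; rewrite ?mulr0 // coefZ rmorphM mulrA.
Qed.

Lemma recip_recip p : (forall a, s (s a) = a) -> s r = r -> p`_0 != 0 ->
  recip (recip p) = r ^+ (size p).-1 *: p.
Proof.
move=> ss sr p0; apply/polyP=> i; rewrite coefZ [LHS]coef_poly size_recip //.
case: ltnP => [li|/leq_sizeP->//]; last by rewrite mulr0.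
rewrite coef_poly (_ : _ < _)%N; last by move: (size p) li => n; lia.
rewrite (_ : (size p).-1 - ((size p).-1 - i) = i)%N; last by move: (size p) li => n; lia.
rewrite rmorphM rmorphXn ss sr -mulrA -exprD mulrC; congr (_ ^+ _ * _).
by move: (size p) li => n; lia.
Qed.

End Reciprocal.

Global Opaque FX toFX tX fracC.

(* The graph of a place N -> F, restricted to the valuation ring. *)
Record place (N F : fieldType) (P : N -> F -> Prop) : Prop := Place {
  place1 : P 1 1;
  placeD : forall x y u v, P x u -> P y v -> P (x + y) (u + v);
  placeN : forall x u, P x u -> P (- x) (- u);
  placeM : forall x y u v, P x u -> P y v -> P (x * y) (u * v);
  placeV : forall x u, P x u -> u != 0 -> P x^-1 u^-1;
  place0 : forall u, P 0 u -> u = 0 }.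

(** * Places, specialising the generators of the tower one by one *)

Section Places.
Variables (F k : fieldType) (P : F -> k -> Prop).
Hypothesis plP : place P.

Lemma place00 : P 0 0.
Proof. by rewrite -(subrr 1) -[X in P _ X](subrr 1); do ?apply: placeD => //; do ?apply: placeN => //; apply: place1. Qed.

Lemma placeX x u n : P x u -> P (x ^+ n) (u ^+ n).
Proof.
by move=> xu; elim: n => [|n IH]; rewrite ?expr0 ?exprS; [apply: place1 | apply: placeM].
Qed.

Lemma place_mmap (K : fieldType) (n : nat) (f : {rmorphism K -> F}) (g : {rmorphism K -> k})
    (h : 'I_n -> F) (v : 'I_n -> k) (p : {mpoly K[n]}) :
  (forall c, P (f c) (g c)) -> (forall i, P (h i) (v i)) ->
  P (mmap f h p) (mmap g v p).
Proof.
move=> Pc Ph; rewrite /mmap; apply: big_rec2 => [|m x y _ xy]; first exact: place00.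
apply: placeD => //; apply: placeM => //; rewrite /mmap1.
apply: big_rec2 => [|i z t _ zt]; first exact: place1.
by apply: placeM => //; apply: placeX.
Qed.

Lemma place_id : place (fun x y : F => x = y).
Proof. by split=> // [x y u v -> ->|x u ->|x y u v -> ->|x u ->]. Qed.

(** The place X = x0, defined on fractions p / q with q(x0) nonzero, composed with the given place
    of F. *)
Lemma place_step (x0 : F) : exists Q : FX F -> k -> Prop,
  [/\ place Q, forall a w, P a w -> Q (fracC a) w & forall w, P x0 w -> Q tX w].
Proof.
pose R (z : FX F) u := exists p q, [/\ q.[x0] != 0, z = toFX p / toFX q & u = p.[x0] / q.[x0]].
have nz q : q.[x0] != 0 -> toFX q != 0 :> FX F.
  by rewrite toFX_eq0; apply: contraNneq => ->; rewrite horner0.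
have plR : place R.
  split.
  - by exists 1, 1; rewrite hornerE oner_neq0 toFX1 !divr1.
  - move=> x y u v [p [q [q0 -> ->]]] [p' [q' [q'0 -> ->]]].
    exists (p * q' + p' * q), (q * q'); rewrite !hornerE mulf_neq0 //; split=> //.
      by rewrite addf_div ?nz // toFXD !toFXM.
    by rewrite addf_div.
  - move=> x u [p [q [q0 -> ->]]]; exists (- p), q; rewrite q0 hornerN toFXN.
    by rewrite !mulNr.
  - move=> x y u v [p [q [q0 -> ->]]] [p' [q' [q'0 -> ->]]].
    exists (p * p'), (q * q'); rewrite !hornerM mulf_neq0 //; split=> //.
      by rewrite mulf_div !toFXM.
    by rewrite mulf_div.
  - move=> x u [p [q [q0 -> ->]]]; rewrite mulf_eq0 invr_eq0 negb_or => /andP[p0 _].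
    by exists q, p; rewrite p0 !invf_div.
  - move=> u [p [q [q0 /eqP e ->]]]; move: e; rewrite eq_sym mulf_eq0 invr_eq0 (negPf (nz _ q0)) orbF.
    by rewrite toFX_eq0 => /eqP->; rewrite horner0 mul0r.
exists (fun z w => exists u, R z u /\ P u w); split; last 2 first.
- move=> a w aw; exists a; split=> //; exists a%:P, 1.
  by rewrite !hornerE oner_neq0 toFX1 !divr1.
- move=> w xw; exists x0; split=> //; exists 'X, 1.
  by rewrite !hornerE oner_neq0 toFX1 !divr1.
split.
- by exists 1; split; apply: place1.
- by move=> x y u v [u' [? ?]] [v' [? ?]]; exists (u' + v'); split; apply: placeD.
- by move=> x u [u' [? ?]]; exists (- u'); split; apply: placeN.
- by move=> x y u v [u' [? ?]] [v' [? ?]]; exists (u' * v'); split; apply: placeM.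
- move=> x u [u' [Ru Pu]] u0; exists u'^-1; split; apply: placeV => //.
  by apply: contraNneq u0 => u'0; rewrite u'0 in Pu; rewrite (place0 plP Pu).
- by move=> u [u' [/(place0 plR)-> /(place0 plP)]].
Qed.

End Places.

(** * Leading terms, and norm equations under X |-> r X *)

Section LeadingCoefficient.
Variable F : fieldType.
Implicit Types (p q : {poly F}) (y z : FX F) (u v : F).

(* u is the coefficient of the leading term u X^(n - m) of z. *)
Definition lead_term z u n m : Prop := exists p q, [/\ p != 0, q != 0,
  z = toFX p / toFX q, u = lead_coef p / lead_coef q
  & (n = (size p).-1)%N /\ (m = (size q).-1)%N].

Lemma lead_term_ex z : z != 0 -> exists u n m, lead_term z u n m.
Proof.
have [p [q [q0 ->]]] := FXP z => pq0.
have p0 : p != 0 by apply: contraNneq pq0 => ->; rewrite toFX0 mul0r.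
by exists (lead_coef p / lead_coef q), (size p).-1, (size q).-1, p, q.
Qed.

Lemma lead_term_inj z u n m u' n' m' :
  lead_term z u n m -> lead_term z u' n' m' -> u = u' /\ (n + m' = n' + m)%N.
Proof.
move=> [p [q [p0 q0 -> -> [-> ->]]]] [p' [q' [p'0 q'0 /eqP e -> [-> ->]]]].
move: e; rewrite eqr_div ?toFX_eq0 // -!toFXM toFX_eq => /eqP e; split.
  by apply/eqP; rewrite eqr_div ?lead_coef_eq0 // -!lead_coefM e.
have := congr1 (fun r : {poly F} => size r) e; rewrite !size_mul //.
move: p0 q0 p'0 q'0; rewrite -!size_poly_gt0.
by move: (size p) (size q) (size p') (size q') => i j k l; lia.
Qed.

Lemma lead_termM y z u n m v n' m' : lead_term y u n m -> lead_term z v n' m' ->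
  lead_term (y * z) (u * v) (n + n') (m + m').
Proof.
move=> [p [q [p0 q0 -> -> [-> ->]]]] [p' [q' [p'0 q'0 -> -> [-> ->]]]].
exists (p * p'), (q * q'); rewrite !mulf_neq0 // !lead_coefM !mulf_div !toFXM !size_mul //.
split=> //; move: p0 q0 p'0 q'0; rewrite -!size_poly_gt0.
by move: (size p) (size q) (size p') (size q') => i j k l; lia.
Qed.

Lemma lead_termC u : u != 0 -> lead_term (fracC u) u 0 0.
Proof.
move=> u0; exists u%:P, 1; rewrite polyC_eq0 oner_neq0 lead_coefC lead_coef1.
by rewrite size_polyC size_poly1 u0 toFX1 !divr1.
Qed.

Lemma lead_termX n : lead_term (tX ^+ n) 1 n 0.
Proof.
exists 'X^n, 1; rewrite expf_neq0 ?polyX_eq0 // oner_neq0 lead_coefXn lead_coef1.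
by rewrite size_polyXn size_poly1 toFX1 !divr1 toFXXn.
Qed.

Variables (s : {rmorphism F -> F}) (r : F) (g : {rmorphism FX F -> FX F}).
Hypothesis r0 : r != 0.
Hypothesis gC : forall a, g (fracC a) = fracC (s a).

Lemma aut_toFX z : g tX = z -> forall p, g (toFX p) = subst_poly s z p.
Proof.
move=> gX; elim/poly_ind => [|p c IH]; first by rewrite toFX0 !rmorph0.
rewrite toFXD toFXM rmorphD rmorphM [LHS]/= IH gX.
by rewrite [RHS]rmorphD rmorphM subst_polyX subst_polyC -gC.
Qed.

Hypothesis gX : g tX = fracC r * tX.

Lemma lead_term_scale z u n m :
  lead_term z u n m -> lead_term (g z) (s u * (r ^+ n / r ^+ m)) n m.
Proof.
move=> [p [q [p0 q0 -> -> [-> ->]]]].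
pose tw (f : {poly F}) := \poly_(i < size f) (s f`_i * r ^+ i).
have twE f : g (toFX f) = toFX (tw f) by rewrite (aut_toFX gX) subst_scale.
have tw0 (f : {poly F}) : f != 0 -> s f`_(size f).-1 * r ^+ (size f).-1 != 0.
  by move=> f0; rewrite mulf_neq0 ?expf_neq0 // fmorph_eq0 -lead_coefE lead_coef_eq0.
have sz (f : {poly F}) : f != 0 -> size (tw f) = size f.
  by move=> f0; rewrite size_poly_eq // tw0.
have ld (f : {poly F}) : f != 0 -> lead_coef (tw f) = s (lead_coef f) * r ^+ (size f).-1.
  by move=> f0; rewrite lead_coef_poly ?size_poly_gt0 ?tw0.
have tw_neq0 (f : {poly F}) : f != 0 -> tw f != 0 by move=> f0; rewrite -size_poly_gt0 sz // size_poly_gt0.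
exists (tw p), (tw q); rewrite !tw_neq0 // !sz // !ld // fmorph_div !twE; split=> //.
by rewrite fmorph_div mulf_div.
Qed.

(** [z] and [g z] have the same degree, so their product has even degree. *)
Lemma norm_parity z u i j : u != 0 ->
  tX ^+ i * (z * g z) = fracC u * tX ^+ j -> odd i = odd j.
Proof.
move=> u0 e; have [z0|z0] := eqVneq z 0.
  move/eqP: e; rewrite z0 mul0r mulr0 eq_sym mulf_eq0 expf_eq0 (negPf (tX_neq0 _)) andbF orbF.
  by rewrite fmorph_eq0 (negPf u0).
have [v [n [m lz]]] := lead_term_ex z0.
have := lead_termM (lead_termX i) (lead_termM lz (lead_term_scale lz)); rewrite e.
by case/lead_term_inj/(_ (lead_termM (lead_termC u0) (lead_termX j))) => _; lia.
Qed.

End LeadingCoefficient.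

(** Removes the variable T. The right-hand side has degree 0, hence so has [z]; no power of [r]
    remains and the leading coefficient solves the same equations. *)
Lemma norm_lead_coef (F : fieldType) (s1 s2 : {rmorphism F -> F}) (r c : F)
    (g1 g2 : {rmorphism FX F -> FX F}) (z : FX F) : r != 0 ->
  (forall a, g1 (fracC a) = fracC (s1 a)) -> g1 tX = fracC r * tX ->
  (forall a, g2 (fracC a) = fracC (s2 a)) -> g2 tX = tX ->
  c != 0 -> z * g1 z = fracC c -> g2 z = z -> exists y, y * s1 y = c /\ s2 y = y.
Proof.
move=> r0 g1C g1X g2C g2X c0 e1 e2.
have z0 : z != 0.
  by apply: contraTneq c0 => z0; rewrite negbK -(fmorph_eq0 fracC) -e1 z0 mul0r.
have [u [n [m lz]]] := lead_term_ex z0; exists u; split.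
  have := lead_termM lz (lead_term_scale r0 g1C g1X lz); rewrite e1.
  case/lead_term_inj/(_ (lead_termC c0)) => <- e.
  have -> : n = m by lia.
  by rewrite divff ?mulr1 // expf_neq0.
have g2X' : g2 tX = fracC 1 * tX by rewrite rmorph1 mul1r.
have := lead_term_scale (oner_neq0 _) g2C g2X' lz; rewrite e2 => /lead_term_inj/(_ lz)[].
by rewrite !expr1n divr1 mulr1.
Qed.

Lemma frac_coprimeP (F : fieldType) (z : FX F) :
  exists p q, [/\ q != 0, coprimep p q & z = toFX p / toFX q].
Proof.
have [p [q [q0 ->]]] := FXP z.
have g0 : gcdp p q != 0 by rewrite gcdp_eq0 (negPf q0) andbF.
exists (p %/ gcdp p q), (q %/ gcdp p q); split.
- by apply: contraNneq q0 => e; rewrite -(divpK (dvdp_gcdr p q)) e mul0r.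
- by apply: coprimep_div_gcd; rewrite q0 orbT.
set G := gcdp p q in g0 *.
have -> : toFX p = toFX (p %/ G) * toFX G by rewrite -toFXM divpK // dvdp_gcdl.
have -> : toFX q = toFX (q %/ G) * toFX G by rewrite -toFXM divpK // dvdp_gcdr.
by rewrite -mulf_div divff ?mulr1 // toFX_eq0.
Qed.

Lemma recip_horner1 (F : fieldType) (p : {poly F}) : (recip idfun 1 p).[1] = p.[1].
Proof.
rewrite horner_poly horner_coef (reindex_inj rev_ord_inj) /=; apply: eq_bigr => i _.
rewrite !expr1n !mulr1; congr (_`_ _); have := ltn_ord i.
by move: (size p) (nat_of_ord i) => n j; lia.
Qed.

Lemma cross_mul2 (K : fieldType) (p q p' q' A B : K) : q != 0 -> q' != 0 ->
  p * (p' * A) * B = p / q * (p' / q') * q * (q' * B) * A.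
Proof. by move=> q0 q'0; field; rewrite q0 q'0. Qed.

(* Evaluate at the fixed point X = 1 of the inversion. *)
Lemma norm_inv_square (F : fieldType) (g : {rmorphism FX F -> FX F}) z w :
  (forall a, g (fracC a) = fracC a) -> g tX = tX^-1 -> z * g z = fracC w ->
  exists x, w = x ^+ 2.
Proof.
move=> gC gX; have [p [q [q0 cop ->]]] := frac_coprimeP z.
have [->|p0] := eqVneq p 0.
  by rewrite toFX0 !mul0r => /esym/eqP; rewrite fmorph_eq0 => /eqP->; exists 0; rewrite expr0n.
have gE f : g (toFX f) * tX ^+ (size f).-1 = toFX (recip idfun 1 f).
  by rewrite -subst_recip (aut_toFX (s := idfun) _ gX) // (rmorph1 fracC) div1r.
rewrite fmorph_div => e.
have e' : p * recip idfun 1 p * 'X ^+ (size q).-1 = w%:P * q * recip idfun 1 q * 'X ^+ (size p).-1.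
  apply/eqP; rewrite -toFX_eq !toFXM -!gE !toFXXn (_ : toFX w%:P = fracC w) // -e.
  have q0' : toFX q != 0 by rewrite toFX_eq0.
  have gq0 : g (toFX q) != 0 by rewrite fmorph_eq0.
  by apply/eqP; exact: (cross_mul2 _ _ _ _ q0' gq0).
have := congr1 (horner^~ 1) e'; rewrite !hornerM !hornerXn !recip_horner1 hornerC !expr1n !mulr1 => e1.
(* Lowest terms exclude a common root at 1. *)
have [q1|q1] := eqVneq q.[1] 0.
  have p1 : p.[1] = 0 by apply/eqP; move/eqP: e1; rewrite q1 !mulr0 mulf_eq0 orbb.
  have r1 : root p 1 by rewrite rootE p1.
  by have := coprimep_root cop r1; rewrite q1 eqxx.
exists (p.[1] / q.[1]); rewrite expr_div_n expr2 e1; field; exact: q1.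
Qed.

Lemma factor_X (F : fieldType) (p : {poly F}) : p != 0 ->
  exists a (P : {poly F}), P`_0 != 0 /\ p = 'X ^+ a * P.
Proof.
case/(irredp_decomp (irredp_XsubC 0))=> a [P [nP ->]]; exists a, P.
by rewrite subr0; split=> //; move: nP; rewrite dvdp_XsubCl rootE horner_coef0.
Qed.

Lemma cancel_Xn (F : fieldType) (A B : {poly F}) i j : A`_0 != 0 -> B`_0 != 0 ->
  A * 'X ^+ i = B * 'X ^+ j -> i = j /\ A = B.
Proof.
have X0 n : 'X ^+ n != 0 :> {poly F} by rewrite expf_neq0 ?polyX_eq0.
have key (A' B' : {poly F}) n m : (n <= m)%N -> A'`_0 != 0 ->
    A' * 'X ^+ n = B' * 'X ^+ m -> n = m /\ A' = B'.
  move=> /subnKC <-; rewrite exprD mulrCA mulrC => A0 /(mulfI (X0 n)).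
  case: (m - n)%N => [|k] e; first by rewrite addn0 e mulr1.
  by move: A0; rewrite e exprSr mulrA coefMX /= eqxx.
move=> A0 B0 e; case: (leqP i j) => [|/ltnW] le; first exact: key.
by have [-> ->] := key _ _ _ _ le B0 (esym e).
Qed.

Lemma cancel_scale (K : fieldType) (A P B Q l : K) : l != 0 ->
  A * P / (B * Q) = A * (l * P) / (B * (l * Q)).
Proof. by move=> l0; rewrite !(mulrCA _ l) -[RHS]mulf_div divff ?mul1r. Qed.

Lemma mulf_cross (K : fieldType) (A B k P Q : K) :
  A * (k * P) / (B * Q) = k * (A / B) * (P / Q).
Proof. by rewrite mulrCA -[LHS]mulrA -mulf_div mulrA. Qed.

Lemma norm_clear (K : fieldType) (A B n m d P rP Q rQ Ra Rb : K) :
  A != 0 -> B != 0 -> n != 0 -> m != 0 -> Q != 0 -> rQ != 0 -> Rb != 0 ->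
  Ra * (P * rP) * (m * d) =
  A * P / (B * Q) * (Ra / A * (rP / n) / (Rb / B * (rQ / m))) * (Rb * Q * rQ * n * d).
Proof.
by move=> A0 B0 n0 m0 Q0 rQ0 R0; field; rewrite A0 B0 n0 m0 Q0 rQ0 R0.
Qed.

Lemma norm_clear' (K : fieldType) (c D Rb Q rQ n d : K) : d != 0 ->
  c * (D ^+ 2 / d) * (Rb * Q * rQ * n * d) = c * Rb * (D ^+ 2 * Q * rQ) * n.
Proof. by move=> d0; field. Qed.

(** * Norm equations under X |-> r / X, by unique factorisation *)

Section NormDecomposition.
Variables (F : fieldType) (s : {rmorphism F -> F}) (r : F) (g : {rmorphism FX F -> FX F}).
Hypotheses (r0 : r != 0) (ss : forall a, s (s a) = a) (sr : s r = r).
Hypotheses (gC : forall a, g (fracC a) = fracC (s a)) (gX : g tX = fracC r / tX).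
Local Notation recip := (recip s r).
Implicit Types (D N P Q f : {poly F}) (y : FX F) (c k : F).

Lemma aut_recip f : g (toFX f) = toFX (recip f) / tX ^+ (size f).-1.
Proof.
by rewrite -subst_recip (aut_toFX gC gX) mulfK // expf_neq0 // tX_neq0.
Qed.

Lemma aut_tXn n : g (tX ^+ n) = fracC (r ^+ n) / tX ^+ n.
Proof. by rewrite rmorphXn gX expr_div_n -rmorphXn. Qed.

(* A solution y of the norm equation has divisor D + (E - rho E) up to 0 and
   infinity: in lowest terms P/Q, unique factorisation forces P ~ D recip Q. *)
Lemma norm_decomposition D y c : D`_0 != 0 -> c != 0 ->
  (forall N, N %| D ^+ 2 -> size N = size D -> N %= D) -> recip D %= D ->
  y * g y = fracC c * (toFX (D ^+ 2) / tX ^+ (size D).-1) ->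
  exists k a b (Q : {poly F}), [/\ k != 0, Q \is monic, Q`_0 != 0, coprimep (D * recip Q) Q
    & y = fracC k * (tX ^+ a / tX ^+ b) * (toFX (D * recip Q) / toFX Q)].
Proof.
move=> D0 c0 hD rD e.
have nz f : f`_0 != 0 -> f != 0 by apply: contraNneq => ->; rewrite coef0.
have Dn0 := nz _ D0.
have [p [q [q0 cop yE]]] := frac_coprimeP y.
have p0 : p != 0.
  apply: contraTneq D0 => p0; rewrite negbK; move/esym/eqP: e; rewrite yE p0 toFX0 !mul0r.
  rewrite !mulf_eq0 invr_eq0 fmorph_eq0 (negPf c0) expf_eq0 (negPf (tX_neq0 _)) andbF orbF /=.
  by rewrite toFX_eq0 expf_eq0 (negPf Dn0).
have [a [P0 [P00 ep]]] := factor_X p0; have [b [Q0 [Q00 eq]]] := factor_X q0.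
have Q0n := nz _ Q00; have l0 : lead_coef Q0 != 0 by rewrite lead_coef_eq0.
pose l := (lead_coef Q0)^-1; have ln0 : l != 0 by rewrite invr_eq0.
pose P := l *: P0; pose Q := l *: Q0.
have monQ : Q \is monic by rewrite monicE lead_coefZ mulVf.
have Pc0 : P`_0 != 0 by rewrite coefZ mulf_neq0.
have Qc0 : Q`_0 != 0 by rewrite coefZ mulf_neq0.
have Pn := nz _ Pc0; have Qn := nz _ Qc0.
have copPQ : coprimep P Q.
  rewrite coprimepZl // coprimepZr //.
  by move: cop; rewrite ep eq coprimepMl coprimepMr => /andP[_]; rewrite coprimepMr => /andP[].
have {}yE : y = tX ^+ a * toFX P / (tX ^+ b * toFX Q).
  rewrite yE ep eq /P /Q -!mul_polyC !toFXM !toFXXn.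
  have l1 : toFX l%:P != 0 by rewrite toFX_eq0 polyC_eq0.
  exact: cancel_scale.
have key : (r ^+ a)%:P * (P * recip P) * 'X ^+ ((size Q).-1 + (size D).-1) =
    (c * r ^+ b)%:P * (D ^+ 2 * Q * recip Q) * 'X ^+ (size P).-1.
  apply/eqP; rewrite -toFX_eq; apply/eqP.
  rewrite exprD !toFXM !toFX_Xn !toFXC.
  have x0 n : (tX : FX F) ^+ n != 0 by rewrite expf_neq0 ?tX_neq0.
  have q1 : toFX Q != 0 by rewrite toFX_eq0.
  have q2 : toFX (recip Q) != 0 by rewrite toFX_eq0; apply: nz; apply: recip_coef0_neq0.
  have ra : fracC (r ^+ b) != 0 by rewrite fmorph_eq0 expf_neq0.
  transitivity ((y * g y) * (fracC (r ^+ b) * toFX Q * toFX (recip Q) * tX ^+ (size P).-1 * tX ^+ (size D).-1)).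
    rewrite yE fmorph_div !rmorphM !aut_tXn !aut_recip.
    exact: (norm_clear _ _ _ _ (x0 _) (x0 _) (x0 _) (x0 _) q1 q2 ra).
  by rewrite e (rmorphM fracC) toFXXn; exact: (norm_clear' _ _ _ _ _ _ (x0 _)).
have rP0 := recip_coef0_neq0 s r0 Pn; have rQ0 := recip_coef0_neq0 s r0 Qn.
have [||em eA] := @cancel_Xn _ _ _ _ _ _ _ key.
- by rewrite !coef0M coefC eqxx !mulf_neq0 ?expf_neq0.
- by rewrite expr2 !coef0M coefC eqxx !mulf_neq0 ?expf_neq0.
have u0 : r ^+ a != 0 by rewrite expf_neq0.
(* [Q] is prime to [P], so it divides [recip P]. The cofactor [N] has the degree of [D], and N
   recip(N) is D^2 up to a constant. *)
have /dvdpP[N eN] : Q %| recip P.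
  have : Q %| (r ^+ a)%:P * (P * recip P).
    by rewrite eA dvdp_mull // dvdp_mulr // dvdp_mulIr.
  by rewrite mul_polyC dvdpZr // Gauss_dvdpr // coprimep_sym.
have N0 : N`_0 != 0 by move: rP0; rewrite eN coef0M mulf_eq0 negb_or => /andP[].
have Nn := nz _ N0.
have szN : size N = size D.
  have := congr1 (fun f : {poly F} => size f) eN; rewrite size_recip // size_mul //.
  move: em Pn Qn Nn Dn0; rewrite -!size_poly_gt0.
  by move: (size P) (size Q) (size N) (size D); clear; lia.
have eP : r ^+ (size P).-1 *: P = recip N * recip Q.
  by rewrite -(recip_recip r0 ss sr) // eN recipM.
have v0 : r ^+ (size P).-1 != 0 by rewrite expf_neq0.
have eNN : (r ^+ a)%:P * (recip N * N) = (r ^+ (size P).-1 * (c * r ^+ b))%:P * D ^+ 2.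
  apply: (mulIf (mulf_neq0 (nz _ rQ0) Qn)).
  transitivity ((r ^+ a)%:P * ((r ^+ (size P).-1 *: P) * (N * Q))).
    by rewrite eP; ring.
  transitivity ((r ^+ (size P).-1)%:P * ((r ^+ a)%:P * (P * recip P))).
    by rewrite -eN -mul_polyC; ring.
  by rewrite eA polyCM; ring.
(* The hypothesis [hD] is applied for D = 1 and for D irreducible, where a divisor of D^2 of the
   same degree as D can only be D up to a constant. *)
have ND : N %= D.
  apply: hD => //; have : N %| (r ^+ (size P).-1 * (c * r ^+ b))%:P * D ^+ 2.
    by rewrite -eNN; apply/dvdp_mull/dvdp_mulIr.
  by rewrite mul_polyC dvdpZr // !mulf_neq0 ?expf_neq0.
have [t t0 eND] := eqpf_eq _ _ ND.
have rND : recip N %= D by rewrite eND recipZ // (eqp_trans (eqp_scale _ _)) // fmorph_eq0.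
have /eqpf_eq[k k0 ePk] : P %= D * recip Q.
  rewrite -(eqp_ltrans (eqp_scale P v0)) eP; exact: eqp_mulr.
exists k, a, b, Q; split=> //; first by rewrite -(coprimepZl _ _ k0) -ePk.
by rewrite yE ePk -mul_polyC toFXM toFXC mulf_cross.
Qed.

End NormDecomposition.

Lemma norm_ratio_clear (K : fieldType) (k k' A B Q D D' rP n Ra Rb R : K) :
  A != 0 -> B != 0 -> n != 0 -> Q != 0 -> rP != 0 -> Rb != 0 ->
  k * (A / B) * (D * rP / Q) * (k' * (Ra / A / (Rb / B)) * (D' * (Q * R / n) / (rP / n)))
  = k * k' * Ra * R / Rb * (D * D').
Proof.
by move=> A0 B0 n0 Q0 rP0 R0; field; rewrite A0 B0 n0 Q0 rP0 R0.
Qed.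

Lemma div_div_cancel (K : fieldType) (u R X : K) : R != 0 -> X != 0 ->
  u = u / (R / X) * R / X.
Proof. by move=> R0 X0; field; rewrite R0 X0. Qed.

Lemma eqp_same_size (F : fieldType) (p q : {poly F}) : q != 0 -> p %| q ->
  size p = size q -> exists t, t != 0 /\ q = t *: p.
Proof.
move=> q0 pq sz; have /eqpf_eq[t t0 ->] : q %= p by rewrite eqp_sym -dvdp_size_eqp // sz.
by exists t.
Qed.

Section NormOfRatio.
Variables (F : fieldType) (s : {rmorphism F -> F}) (r : F) (g : {rmorphism FX F -> FX F}).
Hypotheses (r0 : r != 0) (ss : forall a, s (s a) = a) (sr : s r = r).
Hypotheses (gC : forall a, g (fracC a) = fracC (s a)) (gX : g tX = fracC r / tX).

Lemma aut_inv_involutive z : g (g z) = z.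
Proof.
apply: (@fracX_eq _ _ (g \o g) idfun) => [a|] /=; first by rewrite !gC ss.
by rewrite gX fmorph_div gC sr gX divKf // fmorph_eq0.
Qed.

(** In the norm of recip(Q) / Q everything cancels except r^(deg Q). This constant carries the
    parity of deg Q on which the end of the argument rests. *)
Lemma norm_ratio k a b (D Q : {poly F}) y : Q`_0 != 0 ->
  y = fracC k * (tX ^+ a / tX ^+ b) * (toFX (D * recip s r Q) / toFX Q) ->
  y * g y = fracC (k * s k * r ^+ a * r ^+ (size Q).-1 / r ^+ b) * (toFX D * g (toFX D)).
Proof.
move=> Q0 ->; have Qn : Q != 0 by apply: contraNneq Q0 => ->; rewrite coef0.
have x0 n : (tX : FX F) ^+ n != 0 by rewrite expf_neq0 ?tX_neq0.
have grQ : g (toFX (recip s r Q)) = toFX Q * fracC (r ^+ (size Q).-1) / tX ^+ (size Q).-1.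
  have := congr1 g (aut_recip gC gX Q); rewrite aut_inv_involutive fmorph_div (aut_tXn gX) => ->.
  have R0 : fracC (r ^+ (size Q).-1) != 0 by rewrite fmorph_eq0 expf_neq0.
  exact: (div_div_cancel _ R0 (x0 _)).
rewrite toFXM; rewrite (rmorphM g) (rmorphM g) gC (fmorph_div g) (fmorph_div g) (rmorphM g) grQ.
rewrite (aut_recip gC gX Q) !(aut_tXn gX).
have q0 : toFX Q != 0 by rewrite toFX_eq0.
have q1 : toFX (recip s r Q) != 0.
  by rewrite toFX_eq0; have := recip_coef0_neq0 s r0 Qn; apply: contraNneq => ->; rewrite coef0.
have R0 : fracC (r ^+ b) != 0 by rewrite fmorph_eq0 expf_neq0.
rewrite (fmorph_div fracC) !(rmorphM fracC).
exact: (norm_ratio_clear _ _ _ _ _ _ (x0 _) (x0 _) (x0 _) q0 q1 R0).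
Qed.

End NormOfRatio.

Section InversionSign.
Variables (F : fieldType) (s1 s2 : {rmorphism F -> F}) (g1 g2 : {rmorphism FX F -> FX F}).
Hypotheses (ss1 : forall a, s1 (s1 a) = a).
Hypotheses (g1C : forall a, g1 (fracC a) = fracC (s1 a)) (g1X : g1 tX = fracC (- 1) / tX).
Hypotheses (g2C : forall a, g2 (fracC a) = fracC (s2 a)) (g2X : g2 tX = fracC (- 1) * tX).

Lemma sign_equation (K : fieldType) (k k' A B A' B' P Q P' Q' : K) :
  B != 0 -> B' != 0 -> A != 0 -> Q != 0 -> Q' != 0 ->
  k' * ((A' * A) / (B' * B)) * (P' / Q') = k * (A / B) * (P / Q) ->
  k' * A' * (P' * Q) = k * B' * (P * Q').
Proof.
move=> B0 B'0 A0 Q0 Q'0 e; apply: (mulIf A0); apply: (mulIf (invr_neq0 B0)).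
transitivity ((k' * ((A' * A) / (B' * B)) * (P' / Q')) * (B' * Q * Q')).
  by field; rewrite B0 B'0 Q'0.
by rewrite e; field; rewrite B0 Q0.
Qed.

(* The eigenvalue eta records the two-element kernel of restriction to the
   function field of the conic attached to R |-> - 1 / R, R |-> - R. *)
Lemma norm_descent_conic y c : c != 0 -> y * g1 y = fracC c -> g2 y = y ->
  exists l e, [/\ e = 1 \/ e = - 1, s2 l = e * l & l * s1 l = e * c].
Proof.
move=> c0 e1 e2; have m1 : (- 1 : F) != 0 by rewrite oppr_eq0 oner_neq0.
have sm1 : s1 (- 1) = - 1 by rewrite rmorphN1.
have sz1 : size (recip s1 (- 1) 1) = 1%N.
  by rewrite size_recip ?size_poly1 // coefC eqxx oner_neq0.
have [|||||k [a [b [Q [k0 monQ Q0 cop yE]]]]] :=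
  @norm_decomposition F s1 (- 1) g1 m1 ss1 sm1 g1C g1X 1 y c.
- by rewrite coefC eqxx oner_neq0.
- exact: c0.
- by move=> N _; rewrite size_poly1 => /eqP; rewrite size_poly_eq1.
- by rewrite -size_poly_eq1 sz1.
- by rewrite size_poly1 expr1n toFX1 expr0 divr1 mulr1.
pose P := recip s1 (- 1) Q; rewrite mul1r in cop; rewrite mul1r -/P in yE.
have Qn := monic_neq0 monQ.
have Pc : P`_0 = (- 1) ^+ (size Q).-1 by rewrite recip_coef0 (monicP monQ) rmorph1 mul1r.
have := @norm_ratio F s1 (- 1) g1 m1 ss1 sm1 g1C g1X k a b 1 Q y Q0.
rewrite mul1r toFX1 rmorph1 !mulr1 e1 => /(_ yE)/fmorph_inj ec.
pose tw (f : {poly F}) := \poly_(i < size f) (s2 f`_i * (- 1) ^+ i).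
have twE f : g2 (toFX f) = toFX (tw f) by rewrite (aut_toFX g2C g2X) subst_scale.
have tw_coef f i : (tw f)`_i = s2 f`_i * (- 1) ^+ i.
  by rewrite coef_poly; case: ltnP => // le; rewrite (nth_default _ le) rmorph0 mul0r.
have sg0 n : (- 1 : F) ^+ n != 0 by rewrite signr_eq0.
have szQ : size (tw Q) = size Q.
  rewrite size_poly_eq // mulf_neq0 // fmorph_eq0 -lead_coefE (monicP monQ) oner_neq0 //.
have twQ0 : tw Q != 0 by rewrite -size_poly_eq0 szQ size_poly_eq0.
have x0 n : (tX : FX F) ^+ n != 0 by rewrite expf_neq0 ?tX_neq0.
have eqn : (s2 k * (- 1) ^+ a)%:P * (tw P * Q) = (k * (- 1) ^+ b)%:P * (P * tw Q).
  apply/eqP; rewrite -toFX_eq; apply/eqP; rewrite !toFXM !toFXC !(rmorphM fracC).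
  have q0 : toFX Q != 0 by rewrite toFX_eq0.
  have q1 : toFX (tw Q) != 0 by rewrite toFX_eq0.
  have Bn : fracC ((- 1 : F) ^+ b) != 0 by rewrite fmorph_eq0 sg0.
  apply: (sign_equation (x0 b) Bn (x0 a) q0 q1).
  rewrite -yE -[RHS]e2 yE (rmorphM g2) (rmorphM g2) g2C !(fmorph_div g2) !twE.
  by rewrite !(rmorphXn g2) g2X !exprMn !(rmorphXn fracC).
(* [Q] is prime to [P], so invariance of y under R |-> - R forces [tw Q] to be a multiple of [Q],
   with factor (-1)^(deg Q) as [Q] is monic. *)
have Qdv : Q %| tw Q.
  have : Q %| (k * (- 1) ^+ b)%:P * (P * tw Q) by rewrite -eqn dvdp_mull // dvdp_mulIr.
  by rewrite mul_polyC dvdpZr ?mulf_neq0 // Gauss_dvdpr // coprimep_sym.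
have [t [t0 et]] := eqp_same_size twQ0 Qdv (esym szQ).
have tE : t = (- 1) ^+ (size Q).-1.
  have := congr1 (fun f : {poly F} => f`_(size Q).-1) et.
  by rewrite tw_coef coefZ -lead_coefE (monicP monQ) rmorph1 mulr1 mul1r.
have eqn2 : (s2 k * (- 1) ^+ a)%:P * tw P = (k * (- 1) ^+ b * t)%:P * P.
  apply: (mulIf Qn); rewrite -[LHS]mulrA eqn et -mul_polyC !polyCM; ring.
have P0 : P`_0 != 0 by rewrite Pc.
(* R |-> - R introduces no sign in the constant term, and the constant term of [P] is itself a
   sign. *)
have := congr1 (fun f : {poly F} => f`_0) eqn2.
rewrite !coefCM tw_coef expr0 mulr1 {1}Pc rmorphXn rmorphN1 -Pc => /(mulIf P0) es.
have sq n : (- 1 : F) ^+ n * (- 1) ^+ n = 1 by rewrite -exprMn mulrNN mulr1 expr1n.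
(* One sign governs both the action of sigma on [k] and the norm of [k]. *)
exists k, ((- 1) ^+ (a + b + (size Q).-1)); split.
- by rewrite -signr_odd; case: odd; rewrite ?expr0 ?expr1; [right | left].
- apply: (mulIf (sg0 a)); rewrite es tE !exprD.
  transitivity (k * (- 1) ^+ b * (- 1) ^+ (size Q).-1 * ((- 1) ^+ a * (- 1) ^+ a)).
    by rewrite sq mulr1.
  by ring.
rewrite ec !exprD; move: (sg0 b) (sq a) (sq b) (sq (size Q).-1).
move: ((- 1) ^+ a) ((- 1) ^+ b) ((- 1) ^+ (size Q).-1) => A B E B0 hA hB hE.
transitivity (k * s1 k * (A * A) * (E * E) * (B / B)); last by ring.
by rewrite hA hE divff // !mulr1.
Qed.

End InversionSign.

Lemma reflect_clear (K : fieldType) (k k' A B E P' Q' Ra Rb P Q N : K) :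
  A != 0 -> B != 0 -> E != 0 -> N != 0 -> Rb != 0 -> Q != 0 -> Q' != 0 ->
  k' * (Ra / A / (Rb / B)) * (P' / N / (Q' / E)) = k * (A / B) * (P / Q) ->
  k' * Ra * (P' * Q) * (B * B * E) = k * Rb * (P * Q') * (A * A * N).
Proof.
move=> A0 B0 E0 N0 R0 Q0 Q'0 e.
transitivity ((k' * (Ra / A / (Rb / B)) * (P' / N / (Q' / E))) * (A * B * N * Rb * Q * Q')).
  by field; rewrite A0 B0 E0 N0 R0 Q'0.
by rewrite e; field; rewrite B0 Q0.
Qed.

(** * Elimination of f *)

Section FinalStep.
Variables (F : fieldType) (s1 s2 : {rmorphism F -> F}) (g1 g2 : {rmorphism FX F -> FX F}).
Variables (h m : F).
Hypotheses (h0 : h != 0) (m0 : m != 0).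
Hypotheses (ss1 : forall a, s1 (s1 a) = a) (ss2 : forall a, s2 (s2 a) = a).
Hypotheses (s1h : s1 h = h) (s2m : s2 m = m) (s1m : s1 m = m^-1).
Hypotheses (g1C : forall a, g1 (fracC a) = fracC (s1 a)) (g1X : g1 tX = fracC h / tX).
Hypotheses (g2C : forall a, g2 (fracC a) = fracC (s2 a)) (g2X : g2 tX = fracC m / tX).

Let D : {poly F} := 'X^2 - (- (m * h))%:P.

(** Since rho sends f to h/f and m to 1/m, it sends f^2 + m h to (h/m) (f^2 + m h) / f^2. *)
Lemma recip_quadratic : recip s1 h D = (h / m) *: D.
Proof.
have sD : size D = 3%N by rewrite size_XnsubC.
apply/polyP=> i; rewrite coefZ coef_poly sD /D !coefB !coefXn !coefC.
case: i => [|[|[|i]]] /=; rewrite ?subr0 ?sub0r ?mulr0 ?rmorph0 ?mul0r ?oppr0 ?mulr0 ?opprK //.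
- by rewrite rmorph1 mul1r; field.
- by rewrite expr0 !mulr1 rmorphM s1m s1h mulrC.
Qed.

Lemma final_clear (K : fieldType) (c' fD X h' m' u : K) : X != 0 -> m' != 0 -> h' != 0 ->
  c' * (fD * (h' / m' * fD / X)) = u * (fD ^+ 2 / (m' * h' * X)) ->
  fD != 0 -> c' * h' ^+ 2 = u.
Proof.
move=> X0 m0' h0' e D0'; apply: (mulIf (_ : fD ^+ 2 / (m' * h' * X) != 0)).
  by rewrite mulf_neq0 ?invr_eq0 ?expf_neq0 ?mulf_neq0.
by rewrite -e; field; rewrite X0 m0' h0'.
Qed.

(* The two equations contradict each other in k(m)(h): the first forces
   e to be odd, the second forces it to be even. *)
Lemma norm_descent_parity l u : u != 0 -> irreducible_poly D ->
  l * g1 l = fracC u * (toFX (D ^+ 2) / (fracC (m * h) * tX ^+ 2)) ->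
  g2 l = fracC u * l ->
  exists k t e, [/\ k * s1 k * h ^+ e.+1 = u & t * s2 t = m ^+ e].
Proof.
move=> u0 irrD e1 e2; have [_ iD] := irrD; have Dn := irredp_neq0 irrD.
have sD : size D = 3%N by rewrite size_XnsubC.
have mh0 : m * h != 0 by rewrite mulf_neq0.
have D0 : D`_0 != 0 by rewrite /D coefB coefXn coefC sub0r opprK.
have c0 : u / (m * h) != 0 by rewrite mulf_neq0 ?invr_eq0.
have x0 n : (tX : FX F) ^+ n != 0 by rewrite expf_neq0 ?tX_neq0.
have [|||k [a [b [Q [k0 monQ Q0 cop yE]]]]] :=
    @norm_decomposition F s1 h g1 h0 ss1 s1h g1C g1X D l (u / (m * h)) D0 c0.
- move=> N ND szN; rewrite eqp_sym.
  have [DN|nDN] := boolP (D %| N); first by rewrite -dvdp_size_eqp // szN.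
  have cND : coprimep N D by rewrite coprimep_sym irreducible_poly_coprime.
  have ND1 : N %| D by move: ND; rewrite expr2 Gauss_dvdpr.
  by rewrite eqp_sym -(dvdp_size_eqp ND1) szN.
- by rewrite recip_quadratic eqp_scale // mulf_neq0 ?invr_eq0.
- by rewrite e1 sD (fmorph_div fracC) mulf_div mulrA.
have Qn := monic_neq0 monQ.
have norm_y := norm_ratio h0 ss1 s1h g1C g1X Q0 yE.
have [P PE] : exists P, P = D * recip s1 h Q by exists (D * recip s1 h Q).
rewrite -PE in cop yE.
have rQc : (recip s1 h Q)`_0 != 0 by apply: recip_coef0_neq0.
have P0 : P`_0 != 0 by rewrite PE coef0M mulf_neq0.
have Pn : P != 0 by apply: contraNneq P0 => ->; rewrite coef0.
have sP : (size P).-1 = ((size Q).-1 + 2)%N.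
  have rQn : recip s1 h Q != 0 by apply: contraNneq rQc => ->; rewrite coef0.
  rewrite PE size_mul // size_recip // sD; move: Qn; rewrite -size_poly_gt0.
  by move: (size Q); clear; lia.
have eqn : (s2 k * m ^+ a)%:P * (recip s2 m P * Q) * 'X ^+ (b + b + (size Q).-1) =
    (u * k * m ^+ b)%:P * (P * recip s2 m Q) * 'X ^+ (a + a + (size P).-1).
  apply/eqP; rewrite -toFX_eq; apply/eqP; rewrite !toFXM !toFX_Xn !toFXC !(rmorphM fracC) !exprD.
  have q0 : toFX Q != 0 by rewrite toFX_eq0.
  have q1 : toFX (recip s2 m Q) != 0.
    by rewrite toFX_eq0; have := recip_coef0_neq0 s2 m0 Qn; apply: contraNneq => ->; rewrite coef0.
  have Bn : fracC (m ^+ b) != 0 by rewrite fmorph_eq0 expf_neq0.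
  apply: (reflect_clear (x0 _) (x0 _) (x0 _) (x0 _) Bn q0 q1).
  transitivity (g2 l); last by rewrite e2 yE !mulrA.
  rewrite yE (rmorphM g2) (rmorphM g2) g2C !(fmorph_div g2).
  by rewrite !(aut_recip g2C g2X) !(aut_tXn g2X).
have rP0 := recip_coef0_neq0 s2 m0 Pn; have rQ0 := recip_coef0_neq0 s2 m0 Qn.
have s2k0 : s2 k != 0 by rewrite fmorph_eq0.
have [||eab eA] := @cancel_Xn _ _ _ _ _ _ _ eqn.
- by rewrite !coef0M coefC eqxx !mulf_neq0 ?expf_neq0.
- by rewrite !coef0M coefC eqxx !mulf_neq0 ?expf_neq0.
(* Powers of f: as deg P = deg Q + 2, the monomial factor of [l] must be f^-1. *)
have eb : b = a.+1 by move: eab; rewrite sP; move: (size Q).-1; clear; lia.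
have Qdv : Q %| recip s2 m Q.
  have : Q %| (u * k * m ^+ b)%:P * (P * recip s2 m Q) by rewrite -eA dvdp_mull // dvdp_mulIr.
  by rewrite mul_polyC dvdpZr ?mulf_neq0 ?expf_neq0 // Gauss_dvdpr // coprimep_sym.
have rQn : recip s2 m Q != 0 by apply: contraNneq rQ0 => ->; rewrite coef0.
have [t [t0 et]] := eqp_same_size rQn Qdv (esym (size_recip s2 m Q0)).
(* The exponent e is deg Q. Reversing [Q] twice gives t s2(t) = m^(deg Q). The norm formula
   contributes h^(deg Q - 1), and h/m from [recip_quadratic] against 1/(m h) contributes h^2, whence
   e + 1. *)
exists k, t, (size Q).-1; split; last first.
  have := recip_recip m0 ss2 s2m Q0; rewrite et recipZ // et scalerA => e.
  by move: (congr1 lead_coef e); rewrite !lead_coefZ (monicP monQ) !mulr1 mulrC.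
move: norm_y; rewrite e1 (aut_recip g1C g1X) recip_quadratic sD.
rewrite -mul_polyC toFXM toFXC !(fmorph_div fracC) toFXXn (rmorphM fracC m).
have fD : toFX D != 0 by rewrite toFX_eq0.
have [m0' h0'] : (fracC m != 0) /\ (fracC h != 0) by rewrite !fmorph_eq0.
move=> /esym e; have := final_clear (x0 2) m0' h0' e fD; rewrite -(rmorphXn fracC) -(fmorph_div fracC) -(rmorphM fracC) => /fmorph_inj <-.
by rewrite eb !exprS; field; rewrite h0 expf_neq0.
Qed.

End FinalStep.

Lemma irreducible_quadratic (F : fieldType) (w : F) :
  (forall x, w != x ^+ 2) -> irreducible_poly ('X^2 - w%:P).
Proof.
move=> nsq; apply: cubic_irreducible; first by rewrite size_XnsubC.
move=> x; rewrite rootE !hornerE subr_eq0 eq_sym; exact: nsq.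
Qed.

(** * The tower k(m)(h)(f)(R)(T) with its two automorphisms *)

Lemma fracX_scaleX (F : fieldType) (s : {rmorphism F -> F}) r : r != 0 ->
  exists g : {rmorphism FX F -> FX F},
    (forall a, g (fracC a) = fracC (s a)) /\ g tX = fracC r * tX.
Proof. exact: fracX_aut s r false. Qed.

Lemma fracX_invX (F : fieldType) (s : {rmorphism F -> F}) r : r != 0 ->
  exists g : {rmorphism FX F -> FX F},
    (forall a, g (fracC a) = fracC (s a)) /\ g tX = fracC r / tX.
Proof. exact: fracX_aut s r true. Qed.

Lemma sqr_parity (F : fieldType) (z : FX F) u j : u != 0 ->
  z ^+ 2 = fracC u * tX ^+ j -> ~~ odd j.
Proof.
move=> u0 e; have id1 : idfun tX = fracC 1 * tX :> FX F by rewrite (rmorph1 fracC) mul1r.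
have := norm_parity (oner_neq0 F) (fun a => erefl : idfun (fracC a) = fracC (idfun a)) id1 (z := z) (i := 0) u0.
by rewrite expr0 mul1r -expr2 => /(_ _ e) <-.
Qed.

Lemma inversion_field (k : fieldType) : exists (A : fieldType) (C : {rmorphism k -> A})
    (r : {rmorphism A -> A}) (m : A),
  [/\ m != 0, forall a, r (C a) = C a, r m = m^-1 /\ (forall z, r (r z) = z),
   forall z e, z ^+ 2 = m ^+ e -> ~~ odd e &
   forall m0, exists P : A -> k -> Prop, [/\ place P, forall a, P (C a) a & P m m0]].
Proof.
have [r [rC rX]] := @fracX_invX k idfun 1 (oner_neq0 _).
rewrite (rmorph1 fracC) div1r in rX.
exists (FX k), fracC, r, tX; split=> //; first exact: tX_neq0.
- split=> // z.
  by apply: (@fracX_eq _ _ (r \o r) idfun) => [a|] /=; rewrite ?rC // rX fmorphV rX invrK.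
- move=> z e ez; apply: (@sqr_parity _ z 1); first exact: oner_neq0.
  by rewrite (rmorph1 fracC) mul1r.
- move=> m0; have [P [plP PC PX]] := place_step (place_id k) m0.
  by exists P; split=> // [a|]; [exact: PC | exact: PX].
Qed.

(* k(m)(h) with rho : (m, h) |-> (1/m, h) and sigma : (m, h) |-> (m, 1/h). *)
Lemma biquadratic_base (k : fieldType) : exists (B : fieldType) (C : {rmorphism k -> B})
    (r s : {rmorphism B -> B}) (m h : B),
  [/\ m != 0 /\ h != 0,
   (forall a, r (C a) = C a) /\ (forall a, s (C a) = C a),
   [/\ r m = m^-1, r h = h & forall z, r (r z) = z] /\
   [/\ s m = m, s h = h^-1 & forall z, s (s z) = z],
   (forall z, - (m * h) != z ^+ 2) /\
   (forall x y e u, u = 1 \/ u = - 1 -> x * r x * h ^+ e.+1 = u -> y * s y <> m ^+ e) &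
   forall m0 h0, exists P : B -> k -> Prop,
     [/\ place P, forall a, P (C a) a, P m m0 & P h h0]].
Proof.
have [A [C [q [m [m0 qC [qm qK] m_sq plA]]]]] := inversion_field k.
have [r [rC rX]] := @fracX_scaleX A q 1 (oner_neq0 _).
have [s [sC sX]] := @fracX_invX A idfun 1 (oner_neq0 _).
have rX1 : r tX = tX by rewrite rX (rmorph1 fracC) mul1r.
have sX1 : s tX = tX^-1 by rewrite sX (rmorph1 fracC) div1r.
exists (FX A), (fracC \o C), r, s, (fracC m), tX; split.
- by split; [rewrite (fmorph_eq0 fracC) | apply: tX_neq0].
- by split=> a /=; rewrite ?rC ?sC ?qC.
- split; split=> //.
  + by rewrite rC qm (fmorphV fracC).
  + move=> z; apply: (@fracX_eq _ _ (r \o r) idfun) => [a|] /=; first by rewrite !rC qK.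
    by rewrite !rX1.
  + move=> z; apply: (@fracX_eq _ _ (s \o s) idfun) => [a|] /=; first by rewrite !sC.
    by rewrite sX1 (fmorphV s) sX1 invrK.
- split=> [z|x y e u uE e1 e2].
    apply/eqP => e; have := @sqr_parity A z (- m) 1; rewrite oppr_eq0 => /(_ m0).
    by rewrite expr1 (rmorphN fracC) mulNr -e => /(_ erefl).
  (* rho fixes h, so x r(x) has even degree in h, and e + 1 is even. *)
  have oe : odd e.
    have [v [v0 ev]] : exists v, v != 0 /\ u = fracC v.
      by case: uE => ->; [exists 1 | exists (- 1)];
        rewrite ?(rmorphN1 fracC) ?(rmorph1 fracC) ?oppr_eq0 oner_neq0.
    have := norm_parity (oner_neq0 A) rC rX (z := x) (i := e.+1) (j := 0) v0.
    by rewrite expr0 mulr1 -ev mulrC /= => /(_ e1)/negbFE.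
  (* sigma inverts h and is trivial on k(m): at h = 1 the norm becomes a square. *)
  have [z ez] : exists z, m ^+ e = z ^+ 2.
    by apply: (@norm_inv_square A s y) => //; rewrite e2 (rmorphXn fracC).
  by have := m_sq z e (esym ez); rewrite oe.
- move=> m1 h1; have [P [plP PC Pm]] := plA m1.
  have [Q [plQ QC QX]] := place_step plP (C h1).
  exists Q; split=> // [a||]; [exact/QC/PC | exact: QC | exact/QX/PC].
Qed.

(* k(m)(h)(f) with rho : (m, h, f) |-> (1/m, h, h/f), sigma : (m, 1/h, m/f). *)
Lemma torus_field (k : fieldType) : exists (K : fieldType) (C : {rmorphism k -> K})
    (rho sigma : {rmorphism K -> K}) (m h f : K),
  [/\ [/\ m != 0, h != 0 & f != 0],
   (forall a, rho (C a) = C a) /\ (forall a, sigma (C a) = C a),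
   [/\ rho m = m^-1, rho h = h & rho f = h / f] /\
   [/\ sigma m = m, sigma h = h^-1 & sigma f = m / f],
   [/\ forall z, rho (rho z) = z, f ^+ 2 + m * h != 0 &
    forall l e, e = 1 \/ e = - 1 -> sigma l = e * l ->
      l * rho l <> e * ((f ^+ 2 + m * h) ^+ 2 / (m * h * f ^+ 2))] &
   forall m0 h0 f0, exists P : K -> k -> Prop,
     [/\ place P, forall a, P (C a) a & [/\ P m m0, P h h0 & P f f0]]].
Proof.
have [B [C [r [s [m [h [[m0 h0] [rC sC] [[rm rh rK] [sm sh sK]] [nsq par] plB]]]]]]] :=
  biquadratic_base k.
have [g1 [g1C g1X]] := @fracX_invX B r h h0.
have [g2 [g2C g2X]] := @fracX_invX B s m m0.
have DE : tX ^+ 2 + fracC m * fracC h = toFX ('X^2 - (- (m * h))%:P).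
  by rewrite toFXD toFX_Xn -polyCN opprK toFXC (rmorphM fracC).
exists (FX B), (fracC \o C), g1, g2, (fracC m), (fracC h), tX; split.
- by split; rewrite ?(fmorph_eq0 fracC) //; apply: tX_neq0.
- by split=> a /=; rewrite ?g1C ?g2C ?rC ?sC.
- split; split=> //; first by rewrite g1C rm (fmorphV fracC).
  + by rewrite g1C rh.
  + by rewrite g2C sm.
  + by rewrite g2C sh (fmorphV fracC).
- split=> [z||l e eE e2 e1].
  + exact: (aut_inv_involutive h0 rK rh g1C g1X).
  + by rewrite DE toFX_eq0 irredp_neq0 //; apply: irreducible_quadratic.
  have [u [u0 uE ue]] : exists u, [/\ u != 0, u = 1 \/ u = - 1 & e = fracC u].
    case: eE => ->; [exists 1 | exists (- 1)]; split; try by [left | right].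
    - exact: oner_neq0.
    - by rewrite (rmorph1 fracC).
    - by rewrite oppr_eq0 oner_neq0.
    - by rewrite (rmorphN1 fracC).
  rewrite ue in e1 e2; rewrite DE -toFXXn -(rmorphM fracC) in e1.
  have [x [y [n [ex ey]]]] := norm_descent_parity h0 m0 rK sK rh sm rm g1C g1X g2C g2X u0
    (irreducible_quadratic nsq) e1 e2.
  exact: par uE ex ey.
- move=> m1 h1 f1; have [P [plP PC Pm Ph]] := plB m1 h1.
  have [Q [plQ QC QX]] := place_step plP (C f1).
  exists Q; split=> // [a|]; first exact/QC/PC.
  by split; [exact/QC | exact/QC | exact/QX/PC].
Qed.

Lemma conic_norm_clear (K : fieldType) (w x D : K) : w != 0 -> x != 0 -> D != 0 ->
  D ^+ 2 / (w * x ^+ 2) != 0.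
Proof. by move=> w0 x0 D0; rewrite mulf_neq0 ?invr_eq0 ?mulf_neq0 ?expf_neq0. Qed.

(** T is removed before R because rho T = - R T involves R. Throughout both eliminations c is a
    constant, as it lies in k(m)(h)(f). *)
Lemma action_field (k : fieldType) : exists (N : fieldType) (C : {rmorphism k -> N})
    (rho sigma : {rmorphism N -> N}) (m h f R T : N),
  [/\ [/\ m != 0, h != 0 & f != 0],
   (forall a, rho (C a) = C a) /\ (forall a, sigma (C a) = C a),
   [/\ rho m = m^-1, rho h = h, rho f = h / f, rho R = - R^-1 & rho T = - R * T] /\
   [/\ sigma m = m, sigma h = h^-1, sigma f = m / f, sigma R = - R & sigma T = T],
   (forall y, sigma y = y -> y * rho y <> (f ^+ 2 + m * h) ^+ 2 / (m * h * f ^+ 2)) &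
   forall m0 h0 f0 R0 T0, exists P : N -> k -> Prop,
     place P /\ [/\ forall a, P (C a) a, [/\ P m m0, P h h0 & P f f0], P R R0 & P T T0]].
Proof.
have [K [C [r3 [s3 [m [h [f [[m0 h0 f0] [rC sC] [[rm rh rf] [sm sh sf]] [rK D0 nosol] plK]]]]]]]] :=
  torus_field k.
have N1 : (- 1 : K) != 0 by rewrite oppr_eq0 oner_neq0.
have [r4 [r4C r4X]] := @fracX_invX K r3 (- 1) N1.
have [s4 [s4C s4X]] := @fracX_scaleX K s3 (- 1) N1.
have R0 : - (tX : FX K) != 0 by rewrite oppr_eq0; apply: tX_neq0.
have [r5 [r5C r5X]] := @fracX_scaleX (FX K) r4 (- tX) R0.
have [s5 [s5C s5X]] := @fracX_scaleX (FX K) s4 1 (oner_neq0 _).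
have s5X1 : s5 tX = tX by rewrite s5X (rmorph1 fracC) mul1r.
pose j : {rmorphism K -> FX (FX K)} := (fracC \o fracC).
have r5j a : r5 (j a) = j (r3 a) by rewrite /= r5C r4C.
have s5j a : s5 (j a) = j (s3 a) by rewrite /= s5C s4C.
exists (FX (FX K)), (j \o C), r5, s5, (j m), (j h), (j f), (fracC tX), tX; split.
- by split; rewrite (fmorph_eq0 j).
- split=> a.
    by change (r5 (j (C a)) = j (C a)); rewrite r5j rC.
  by change (s5 (j (C a)) = j (C a)); rewrite s5j sC.
- split; split.
  + by rewrite r5j rm (fmorphV j).
  + by rewrite r5j rh.
  + by rewrite r5j rf (fmorph_div j).
  + by rewrite r5C r4X (rmorphN1 fracC) mulN1r (rmorphN fracC) (fmorphV fracC).
  + by rewrite r5X (rmorphN fracC).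
  + by rewrite s5j sm.
  + by rewrite s5j sh (fmorphV j).
  + by rewrite s5j sf (fmorph_div j).
  + by rewrite s5C s4X (rmorphN1 fracC) mulN1r (rmorphN fracC).
  + exact: s5X1.
- move=> y ys.
  pose c := (f ^+ 2 + m * h) ^+ 2 / (m * h * f ^+ 2).
  have c0 : c != 0 by apply: conic_norm_clear => //; rewrite mulf_neq0.
  have -> : (j f ^+ 2 + j m * j h) ^+ 2 / (j m * j h * j f ^+ 2) = fracC (fracC c).
    rewrite (_ : fracC (fracC c) = j c) // (fmorph_div j) (rmorphXn j) (rmorphD j).
    by rewrite (rmorphM j (m * h)) (rmorphM j m) !(rmorphXn j).
  move=> e; have fc0 : (fracC c : FX K) != 0 by rewrite (fmorph_eq0 fracC).
  have [z [ez sz]] := norm_lead_coef R0 r5C r5X s5C s5X1 fc0 e ys.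
  have [l [u [uE sl el]]] := norm_descent_conic rK r4C r4X s4C s4X c0 ez sz.
  exact: nosol uE sl el.
- move=> m1 h1 f1 R1 T1; have [P [plP PC [Pm Ph Pf]]] := plK m1 h1 f1.
  have [Q [plQ QC QX]] := place_step plP (C R1).
  have [Q' [plQ' QC' QX']] := place_step plQ (fracC (C T1)).
  exists Q'; split=> //; split.
  + by move=> a; exact/QC'/QC/PC.
  + by split; apply/QC'/QC.
  + exact/QC'/QX/PC.
  + exact/QX'/QC/PC.
Qed.

Section CommonFixedField.
Variables (N : fieldType) (g1 g2 : {rmorphism N -> N}).

Definition common_fixed : {pred N} := [pred z | (g1 z == z) && (g2 z == z)].

Lemma common_fixedP z : reflect (g1 z = z /\ g2 z = z) (z \in common_fixed).
Proof. by apply: (iffP andP) => -[/eqP-> /eqP->]. Qed.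

Lemma common_fixed_divring_closed : divring_closed common_fixed.
Proof.
split=> [|x y /common_fixedP[x1 x2] /common_fixedP[y1 y2]|x y /common_fixedP[x1 x2] /common_fixedP[y1 y2]];
  apply/common_fixedP.
- by rewrite !rmorph1.
- by rewrite !rmorphB x1 x2 y1 y2.
- by rewrite !fmorph_div x1 x2 y1 y2.
Qed.

HB.instance Definition _ :=
  GRing.isDivringClosed.Build N common_fixed common_fixed_divring_closed.

Record common_fixed_field := CommonFixedField {
  common_fixed_val : N; _ : common_fixed_val \in common_fixed }.

HB.instance Definition _ := [isSub for common_fixed_val].
HB.instance Definition _ := [Choice of common_fixed_field by <:].
HB.instance Definition _ := [SubChoice_isSubIntegralDomain of common_fixed_field by <:].
HB.instance Definition _ := [SubIntegralDomain_isSubField of common_fixed_field by <:].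

(** The tower supplies two endomorphisms rather than an action of a finite group, so [fixed_field]
    does not apply to it. *)
Lemma common_fixed_subfield : exists (E : fieldType) (i : {rmorphism E -> N}),
  (forall e, g1 (i e) = i e /\ g2 (i e) = i e) /\
  (forall z, g1 z = z -> g2 z = z -> exists e, i e = z).
Proof.
exists common_fixed_field, (val : {rmorphism common_fixed_field -> N}); split.
  by move=> e; apply/common_fixedP; apply: valP.
move=> z z1 z2; have zf : z \in common_fixed by apply/common_fixedP.
by exists (CommonFixedField zf).
Qed.

End CommonFixedField.

Lemma rmorph_factor (L E N : fieldType) (u : {rmorphism L -> N}) (i : {rmorphism E -> N}) :
  (forall z, exists e, i e = u z) -> exists w : {rmorphism L -> E}, forall z, i (w z) = u z.
Proof.
move=> /choice[w wE].
have wB : zmod_morphism w by move=> x y; apply: (fmorph_inj i); rewrite rmorphB !wE rmorphB.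
have wM : monoid_morphism w.
  by split=> [|x y]; apply: (fmorph_inj i); rewrite ?rmorphM ?rmorph1 !wE ?rmorphM ?rmorph1.
pose wz := GRing.isZmodMorphism.Build _ _ w wB.
pose wm := GRing.isMonoidMorphism.Build _ _ w wM.
pose wr : {rmorphism L -> E} := HB.pack w wz wm.
by exists wr.
Qed.

Lemma ratfun_rmorph_eq (k N : fieldType) (n : nat) (g h : {rmorphism ratfun k n -> N}) :
  (forall c, g (ratC k n c) = h (ratC k n c)) ->
  (forall i, g (ratX k i) = h (ratX k i)) -> g =1 h.
Proof.
move=> eC eX z; have [p [q [q0 ->]]] := fracP z; rewrite !fmorph_div.
suff e f : g (tofrac f) = h (tofrac f) by rewrite !e.
pose t : {rmorphism {mpoly k[n]} -> ratfun k n} := @tofrac {mpoly k[n]}.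
pose gt : {rmorphism {mpoly k[n]} -> N} := g \o t.
pose ht : {rmorphism {mpoly k[n]} -> N} := h \o t.
apply: (etrans (rmorph_mpoly gt f)); apply/esym/(etrans (rmorph_mpoly ht f))/esym.
apply: eq_bigr => m _; congr (_ * _); first exact: eC.
by apply: eq_bigr => i _; congr (_ ^+ _); apply: eX.
Qed.

(** * Embedding k(x1,...,x5) into the tower *)

Lemma ord5_ind (P : 'I_5 -> Prop) : P (inord 0) -> P (inord 1) -> P (inord 2) ->
  P (inord 3) -> P (inord 4) -> forall i, P i.
Proof.
move=> p0 p1 p2 p3 p4 i; rewrite -(inord_val i); case: i => i /=.
by case: i => [|[|[|[|[|]]]]].
Qed.

Definition fun5 (T : Type) (a b c d e : T) : 'I_5 -> T := fun i => nth a [:: a; b; c; d; e] i.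

Lemma fun5E (T : Type) (a b c d e : T) (f := fun5 a b c d e) :
  [/\ f (inord 0) = a, f (inord 1) = b, f (inord 2) = c, f (inord 3) = d & f (inord 4) = e].
Proof. by rewrite /f /fun5 !inordK. Qed.

(* The coordinates x_1, ..., x_5 as functions of m, h, f, R, T. *)
Section Coordinates.
Variable N : fieldType.
Variables (m h f R T : N).

Definition coord : 'I_5 -> N := fun5 f (h / f) (f / (m * h))
  ((1 + R * T) / (1 - R * T)) ((1 + T) / (1 - T)).

(** The values of m, h, f, R, T are solved from prescribed x1,...,x5; the condition that v5 is not 1
    keeps the value of T nonzero, so that of R = S/T is finite. *)
Lemma place_coord (k : fieldType) (P : N -> k -> Prop) (v : 'I_5 -> k)
    (v1 := v (inord 0)) (v2 := v (inord 1)) (v3 := v (inord 2))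
    (v4 := v (inord 3)) (v5 := v (inord 4)) :
  place P -> (2%:R : k) != 0 -> v1 != 0 -> v2 != 0 -> v3 != 0 ->
  v4 + 1 != 0 -> v5 + 1 != 0 -> v5 - 1 != 0 ->
  P m (v2 * v3)^-1 -> P h (v1 * v2) -> P f v1 ->
  P R (((v4 - 1) / (v4 + 1)) / ((v5 - 1) / (v5 + 1))) -> P T ((v5 - 1) / (v5 + 1)) ->
  forall i, P (coord i) (v i).
Proof.
move=> plP k2 v10 v20 v30 v40 v50 v51 Pm Ph Pf PR PT.
have [c1 c2 c3 c4 c5] := fun5E f (h / f) (f / (m * h)) ((1 + R * T) / (1 - R * T)) ((1 + T) / (1 - T)).
have pM := placeM plP; have pD := placeD plP; have pV := placeV plP.
have pB x y a b : P x a -> P y b -> P (x - y) (a - b) by move=> ? ?; apply: pD => //; apply: placeN.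
have pdiv x y a b : P x a -> P y b -> b != 0 -> P (x / y) (a / b).
  by move=> ? ? ?; apply: pM => //; apply: pV.
have p1 := place1 plP.
have E : (v4 - 1) / (v4 + 1) / ((v5 - 1) / (v5 + 1)) * ((v5 - 1) / (v5 + 1)) = (v4 - 1) / (v4 + 1).
  by rewrite divfK // mulf_neq0 ?invr_eq0.
have cay (x : k) : x + 1 != 0 -> (1 + (x - 1) / (x + 1)) / (1 - (x - 1) / (x + 1)) = x /\
    1 - (x - 1) / (x + 1) != 0.
  move=> x0; have e : 1 - (x - 1) / (x + 1) = 2%:R / (x + 1) by field.
  rewrite e mulf_neq0 ?invr_eq0 //; split=> //; field; by rewrite x0.
apply: ord5_ind; rewrite /coord ?c1 ?c2 ?c3 ?c4 ?c5 //.
- by have := pdiv _ _ _ _ Ph Pf v10; rewrite (_ : _ / _ = v2) // mulrAC divff ?mul1r.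
- have mh0 : (v2 * v3)^-1 * (v1 * v2) != 0 by rewrite !mulf_neq0 ?invr_eq0 ?mulf_neq0.
  have := pdiv _ _ _ _ Pf (pM _ _ _ _ Pm Ph) mh0.
  by rewrite (_ : v1 / _ = v3) //; field; rewrite v10 v20 v30.
- have := pM _ _ _ _ PR PT; rewrite E => PS; have [ce c0] := cay v4 v40.
  by have := pdiv _ _ _ _ (pD _ _ _ _ p1 PS) (pB _ _ _ _ p1 PS) c0; rewrite ce.
- have [ce c0] := cay v5 v50.
  by have := pdiv _ _ _ _ (pD _ _ _ _ p1 PT) (pB _ _ _ _ p1 PT) c0; rewrite ce.
Qed.

End Coordinates.

(** Algebraic independence by specialisation: a relation between the coordinates would vanish at
    every k-point reached by a place, but k is infinite. *)
Lemma coord_embedding (k k' N : fieldType) (j : {rmorphism k -> k'}) (C : {rmorphism k' -> N})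
    (m h f R T : N) : infinite_set [set: k]%classic -> (2%:R : k) != 0 ->
  (forall m0 h0 f0 R0 T0, exists P : N -> k' -> Prop,
     place P /\ [/\ forall a, P (C a) a, [/\ P m m0, P h h0 & P f f0], P R R0 & P T T0]) ->
  exists phi : {rmorphism ratfun k 5 -> N},
    (forall c, phi (ratC k 5 c) = C (j c)) /\ (forall i, phi (ratX k i) = coord m h f R T i).
Proof.
move=> kinf k2 pl.
pose e : {rmorphism {mpoly k[5]} -> N} := mmap (C \o j) (coord m h f R T).
have [p|phi phiE] := frac_lift (e := e); last first.
  exists phi; split=> [c|i]; first by rewrite [LHS]phiE /e /= mmapC.
  by rewrite [LHS]phiE /e /= mmapX mmap1U.
move=> ep; apply/eqP/negPn/negP => p0.
pose X i : {mpoly k[5]} := 'X_(inord i).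
(* The extra factors exclude the points outside the reach of [place_coord]. *)
pose q := p * (X 0 * X 1 * X 2) * (X 3 + 1) * ((X 4 + 1) * (X 4 - 1)).
have mX i : X i != 0 by rewrite /X -msupp_eq0 msuppX.
have mXD i : X i + 1 != 0.
  by apply: contraTneq (oner_neq0 k) => /(congr1 (meval (fun=> 0))); rewrite mevalD mevalXU meval1 meval0 add0r => ->; rewrite eqxx.
have mXB i : X i - 1 != 0.
  by apply: contraTneq (oner_neq0 k) => /(congr1 (meval (fun=> 0))) /eqP; rewrite mevalB mevalXU meval1 meval0 sub0r oppr_eq0 => ->.
have q0 : q != 0 by rewrite !mulf_neq0.
have [v] := mpoly_nonvanishing kinf q0.
rewrite !mevalM !mevalD !mevalN !meval1 !mevalXU !mulf_eq0 !negb_or.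
move=> /andP[/andP[/andP[pv /andP[/andP[v0 v1] v2]] v3] /andP[v4 v4']].
pose w i := j (v i).
have jn (x : k) : x != 0 -> j x != 0 by rewrite fmorph_eq0.
have jn1 (x : k) : x + 1 != 0 -> j x + 1 != 0 by rewrite -(rmorph1 j) -rmorphD fmorph_eq0.
have jn2 (x : k) : x - 1 != 0 -> j x - 1 != 0 by rewrite -(rmorph1 j) -rmorphB fmorph_eq0.
have k'2 : (2%:R : k') != 0 by rewrite -(rmorph_nat j) fmorph_eq0.
have [P [plP [PC [Pm Ph Pf] PR PT]]] := pl (w (inord 1) * w (inord 2))^-1 (w (inord 0) * w (inord 1))
  (w (inord 0)) (((w (inord 3) - 1) / (w (inord 3) + 1)) / ((w (inord 4) - 1) / (w (inord 4) + 1)))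
  ((w (inord 4) - 1) / (w (inord 4) + 1)).
have Pc := place_coord plP k'2 (jn _ v0) (jn _ v1) (jn _ v2) (jn1 _ v3) (jn1 _ v4) (jn2 _ v4')
  Pm Ph Pf PR PT.
have := place_mmap plP (f := C \o j) (g := j) p (fun c => PC (j c)) Pc.
rewrite (_ : mmap _ _ p = 0) // => /(place0 plP).
rewrite (_ : mmap j w p = j p.@[v]); first by move/eqP; rewrite fmorph_eq0 (negPf pv).
rewrite [p.@[v]]/meval /mmap rmorph_sum; apply: eq_bigr => i _; rewrite rmorphM; congr (_ * _).
by rewrite /mmap1 rmorph_prod; apply: eq_bigr => l _; rewrite rmorphXn.
Qed.

Definition cayley (K : fieldType) (x : K) : K := (x - 1) / (x + 1).

Lemma cayleyK (K : fieldType) (y : K) : (2%:R : K) != 0 -> 1 - y != 0 ->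
  cayley ((1 + y) / (1 - y)) = y.
Proof.
move=> K2 y1; rewrite /cayley.
have -> : (1 + y) / (1 - y) - 1 = 2%:R * y / (1 - y) by field.
have -> : (1 + y) / (1 - y) + 1 = 2%:R / (1 - y) by field.
by field; rewrite K2 y1.
Qed.

(* a = (S^2 - T^2)^2 and c = 2 + u1 u3 + u2 u4 with u4 = 1 / (x1 x2 x3). *)
Definition slot_a (K : fieldType) (x4 x5 : K) : K := (cayley x4 ^+ 2 - cayley x5 ^+ 2) ^+ 2.
Definition slot_c (K : fieldType) (x1 x2 x3 : K) : K :=
  2%:R + x1 * x3 + x2 * (1 / (x1 * x2 * x3)).

(** x1x3 and x2u4 are mutually inverse, so c = (1 + x1x3)^2 / (x1x3) with x1x3 = f^2 / (m h). *)
Lemma slot_c_torus (K : fieldType) (m h f : K) : m != 0 -> h != 0 -> f != 0 ->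
  slot_c f (h / f) (f / (m * h)) = (f ^+ 2 + m * h) ^+ 2 / (m * h * f ^+ 2).
Proof. by move=> m0 h0 f0; rewrite /slot_c; field; rewrite m0 h0 f0. Qed.

Lemma rmorph_cayley (K L : fieldType) (g : {rmorphism K -> L}) x : g (cayley x) = cayley (g x).
Proof. by rewrite /cayley fmorph_div rmorphB rmorphD rmorph1. Qed.

Lemma rmorph_slot_a (K L : fieldType) (g : {rmorphism K -> L}) x4 x5 :
  g (slot_a x4 x5) = slot_a (g x4) (g x5).
Proof. by rewrite /slot_a rmorphXn rmorphB !rmorphXn !rmorph_cayley. Qed.

Lemma rmorph_slot_c (K L : fieldType) (g : {rmorphism K -> L}) x1 x2 x3 :
  g (slot_c x1 x2 x3) = slot_c (g x1) (g x2) (g x3).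
Proof. by rewrite /slot_c !rmorphD !rmorphM fmorphV !rmorphM !rmorph1. Qed.

(* A nontrivial solution would make Y = (x + sqrt a y) / z an element of norm c. *)
Lemma qsplit_norm_element (E N : fieldType) (i : {rmorphism E -> N}) (g s : {rmorphism N -> N})
    (a c : E) (d : N) : (2%:R : N) != 0 -> d != 0 -> i a = d ^+ 2 -> g d = - d -> s d = d ->
  (forall e, g (i e) = i e /\ s (i e) = i e) -> qsplit a c ->
  exists Y, s Y = Y /\ Y * g Y = i c.
Proof.
move=> N2 d0 ia gd sd fix_i [x [y [z [nz e]]]].
have [gx sx] := fix_i x; have [gy sy] := fix_i y; have [gz sz] := fix_i z.
have e' : i x ^+ 2 = d ^+ 2 * i y ^+ 2 + i c * i z ^+ 2.
  by rewrite -ia -!rmorphXn -!rmorphM -rmorphD e.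
(* With z = 0 the quotient x / y would be [d] or [- d]; but [g] fixes it and negates [d]. *)
have [z0|z0] := eqVneq z 0.
  exfalso; have y0 : y != 0.
    apply: contraTneq nz => y0; rewrite y0 z0 eqxx /= !orbF negbK.
    move/eqP: e; rewrite y0 z0 expr0n /= !mulr0 addr0 expf_eq0 /=; exact.
  have iy0 : i y != 0 by rewrite fmorph_eq0.
  have : (i x / i y) ^+ 2 = d ^+ 2.
    by rewrite expr_div_n e' z0 rmorph0 expr0n /= mulr0 addr0 mulfK // expf_neq0.
  have gq : g (i x / i y) = i x / i y by rewrite fmorph_div gx gy.
  move/eqP; rewrite eqf_sqr => /orP[] /eqP q; rewrite q ?rmorphN gd ?opprK in gq.
    move/eqP: gq; rewrite eq_sym -subr_eq0 opprK -mulr2n -mulr_natl mulf_eq0.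
    by rewrite (negPf N2) (negPf d0).
  move/eqP: gq; rewrite -subr_eq0 opprK -mulr2n -mulr_natl mulf_eq0.
  by rewrite (negPf N2) (negPf d0).
have iz0 : i z != 0 by rewrite fmorph_eq0.
exists ((i x + d * i y) / i z); split.
  by rewrite fmorph_div rmorphD rmorphM sx sy sz sd.
rewrite fmorph_div rmorphD rmorphM gx gy gz gd.
transitivity ((i x ^+ 2 - d ^+ 2 * i y ^+ 2) / i z ^+ 2); first by field.
by rewrite e' addrC addKr mulfK // expf_neq0.
Qed.

(** * The symbol (a, c) does not split over any extension of constants *)

Section Nonsplit.
Variables (k k' : fieldType) (j : {rmorphism k -> k'}).
Hypotheses (k_inf : infinite_set [set: k]%classic) (k2 : (2%:R : k) != 0).
Variables (G : finGroupType) (rho tau : G) (act : kaction (ratC k 5) G).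
Let x1 := ratX k (inord 0 : 'I_5).
Let x2 := ratX k (inord 1 : 'I_5).
Let x3 := ratX k (inord 2 : 'I_5).
Let x4 := ratX k (inord 3 : 'I_5).
Let x5 := ratX k (inord 4 : 'I_5).
Hypothesis act_rho : [/\ act rho x1 = x2, act rho x2 = x1,
  act rho x3 = 1 / (x1 * x2 * x3), act rho x4 = x5 & act rho x5 = 1 / x4].
Hypothesis act_tau : [/\ act tau x1 = x3, act tau x2 = 1 / (x1 * x2 * x3),
  act tau x3 = x1, act tau x4 = x5 & act tau x5 = x4].

(** E consists of the elements of the tower over k' fixed by rho and sigma. It receives L and k'
    compatibly over k, which is what [liftable_split] asks of its field. *)
Lemma nonsplit_extension : exists (E : fieldType) (w : {rmorphism fixed_field act -> E})
    (w' : {rmorphism k' -> E}),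
  (forall c, w (fixed_const act c) = w' (j c)) /\
  (forall a c : fixed_field act, val a = slot_a x4 x5 -> val c = slot_c x1 x2 x3 ->
     ~ qsplit (w a) (w c)).
Proof.
have [N [C [r [s [m [h [f [R [T [[m0 h0 f0] [rC sC] [[rm rh rf rR rT] [sm sh sf sR sT]] nosol pl]]]]]]]]]] :=
  action_field k'.
have [phi [phiC phiX]] := coord_embedding j k_inf k2 pl.
have k'2 : (2%:R : k') != 0 by rewrite -(rmorph_nat j) fmorph_eq0.
have N2 : (2%:R : N) != 0 by rewrite -(rmorph_nat C) fmorph_eq0.
(* Nonvanishing is read off from places. At R = 0, T = 1 the elements 1 - RT and 1 + RT take the
   value 1, and [d] the value -1; m = h = f = 1 is arbitrary. *)
have [P [plP [_ _ PR PT]]] := pl 1 1 1 0 1.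
have p1 := placeM plP PR PT; rewrite mul0r in p1.
have neq0 z u : P z u -> u != 0 -> z != 0.
  by move=> Pz; apply: contraNneq => z0; rewrite z0 in Pz; rewrite (place0 plP Pz).
have RTm : 1 - R * T != 0.
  by apply: (neq0 _ _ (placeD plP (place1 plP) (placeN plP p1))); rewrite subr0 oner_neq0.
have RTp : 1 + R * T != 0.
  by apply: (neq0 _ _ (placeD plP (place1 plP) p1)); rewrite addr0 oner_neq0.
pose d := (R * T) ^+ 2 - T ^+ 2.
have d0 : d != 0.
  apply: (neq0 _ _ (placeD plP (placeX plP 2 p1) (placeN plP (placeX plP 2 PT)))).
  by rewrite expr1n expr0n sub0r oppr_eq0 oner_neq0.
have [Q [plQ [_ _ QR QT]]] := pl 1 1 1 1 0.
have neq0' z u : Q z u -> u != 0 -> z != 0.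
  by move=> Qz; apply: contraNneq => z0; rewrite z0 in Qz; rewrite (place0 plQ Qz).
have R0 : R != 0 by apply: (neq0' _ _ QR); apply: oner_neq0.
have Tm : 1 - T != 0.
  by apply: (neq0' _ _ (placeD plQ (place1 plQ) (placeN plQ QT))); rewrite subr0 oner_neq0.
have [c1 c2 c3 c4 c5] := fun5E f (h / f) (f / (m * h)) ((1 + R * T) / (1 - R * T)) ((1 + T) / (1 - T)).
have [px1 px2 px3 px4 px5] : [/\ phi x1 = f, phi x2 = h / f, phi x3 = f / (m * h),
    phi x4 = (1 + R * T) / (1 - R * T) & phi x5 = (1 + T) / (1 - T)].
  by rewrite /x1 /x2 /x3 /x4 /x5 !phiX.
have pw : phi (1 / (x1 * x2 * x3)) = m / f.
  rewrite fmorph_div rmorph1 !rmorphM px1 px2 px3; field; by rewrite m0 h0 f0.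
have px4V : phi (1 / x4) = (1 - R * T) / (1 + R * T).
  by rewrite fmorph_div rmorph1 px4 div1r invf_div.
have [ar1 ar2 ar3 ar4 ar5] := act_rho; have [at1 at2 at3 at4 at5] := act_tau.
have rRT : r (R * T) = T by rewrite rmorphM rR rT !mulNr mulrN opprK mulKf.
have sRT : s (R * T) = - (R * T) by rewrite rmorphM sR sT mulNr.
have phi_rho : phi \o act rho =1 r \o phi.
  apply: ratfun_rmorph_eq => [c|]; first by rewrite /= kact_const phiC rC.
  apply: ord5_ind => /=; rewrite -?/x1 -?/x2 -?/x3 -?/x4 -?/x5.
  - by rewrite ar1 px1 px2 rf.
  - by rewrite ar2 px1 px2 fmorph_div rh rf invf_div mulrC divfK.
  - by rewrite ar3 pw px3 fmorph_div rmorphM rf rm rh; field; rewrite m0 h0 f0.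
  - by rewrite ar4 px5 px4 fmorph_div rmorphB rmorphD rmorph1 rRT.
  - by rewrite ar5 px4V px5 fmorph_div rmorphB rmorphD rmorph1 rT mulNr opprK.
have pr z : phi (act rho z) = r (phi z) := phi_rho z.
(* For a left action, sigma = rho tau applies tau first. *)
have phi_sigma : phi \o act (rho * tau)%g =1 s \o phi.
  apply: ratfun_rmorph_eq => [c|]; first by rewrite /= kact_const phiC sC.
  apply: ord5_ind => /=; rewrite -?/x1 -?/x2 -?/x3 -?/x4 -?/x5 kactM.
  - by rewrite at1 ar3 pw px1 sf.
  - rewrite at2 pr pw px2 [LHS]fmorph_div [RHS]fmorph_div rm rf sh sf.
    by field; rewrite m0 h0 f0.
  - by rewrite at3 ar1 px2 px3 [RHS]fmorph_div rmorphM sf sm sh; field; rewrite m0 h0 f0.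
  - by rewrite at4 ar5 px4V px4 [RHS]fmorph_div rmorphB rmorphD rmorph1 sRT opprK.
  - by rewrite at5 ar4 px5 [RHS]fmorph_div rmorphB rmorphD rmorph1 sT.
have [E [i [fix_i ex_i]]] := common_fixed_subfield r s.
pose v : {rmorphism fixed_field act -> ratfun k 5} := val.
have [z|w wE] := @rmorph_factor _ E N (phi \o v) i.
  have /fixedP fz : v z \in fixed act by apply: valP.
  apply: ex_i; first by rewrite -[r _](phi_rho (v z)) /= fz.
  by rewrite -[s _](phi_sigma (v z)) /= fz.
have [c|w' w'E] := @rmorph_factor _ E N C i; first exact: ex_i.
exists E, w, w'; split=> [c|a c va vc spl].
  by apply: (fmorph_inj i); rewrite wE w'E; apply: phiC.
have ia : i (w a) = d ^+ 2.
  by rewrite wE [_ a]/= va rmorph_slot_a px4 px5 /slot_a !cayleyK.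
have gd : r d = - d by rewrite rmorphB !rmorphXn rRT rT mulNr sqrrN opprB.
have sd : s d = d by rewrite rmorphB !rmorphXn sRT sT sqrrN.
have [Y [sY nY]] := qsplit_norm_element N2 d0 ia gd sd fix_i spl.
apply: (nosol Y sY); rewrite nY wE [_ c]/= vc rmorph_slot_c px1 px2 px3.
exact: slot_c_torus.
Qed.

End Nonsplit.

Lemma mmap_rmorph_eq (k : fieldType) (n : nat) (S : comNzRingType) (g h : {rmorphism {mpoly k[n]} -> S}) :
  (forall c, g c%:MP = h c%:MP) -> (forall i, g 'X_i = h 'X_i) -> g =1 h.
Proof.
move=> eC eX p; rewrite (rmorph_mpoly g) (rmorph_mpoly h).
apply: eq_bigr => m _; congr (_ * _); first exact: eC.
by apply: eq_bigr => i _; congr (_ ^+ _); apply: eX.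
Qed.

(** * From lifted relations to splitting along a line *)

Section Lifting.
Variables (k L : fieldType) (iota : {rmorphism k -> L}).

(* The elements of zs are, up to a common factor w, values at a point of
   affine space of polynomials satisfying the same homogeneous relations. *)
Definition liftable (zs : seq L) : Prop :=
  exists (n : nat) (P : 'I_n -> L) (num : L -> {mpoly k[n]}) (w : L),
  [/\ w != 0, forall z, z \in zs -> mmap iota P (num z) = w * z,
   forall a b x y z, a \in zs -> b \in zs -> x \in zs -> y \in zs -> z \in zs ->
     x ^+ 2 = a * y ^+ 2 + b * z ^+ 2 ->
     num 1 * num x ^+ 2 = num a * num y ^+ 2 + num b * num z ^+ 2 &
   forall a b c d x y z, a \in zs -> b \in zs -> c \in zs -> d \in zs ->
     x \in zs -> y \in zs -> z \in zs ->
     x ^+ 2 = a * b * y ^+ 2 + c * d * z ^+ 2 ->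
     num 1 ^+ 2 * num x ^+ 2 = num a * num b * num y ^+ 2 + num c * num d * num z ^+ 2].

Section Line.
Variables (n : nat) (P : 'I_n -> L) (v : 'I_n -> k) (E : fieldType).
Variables (w : {rmorphism L -> E}) (w' : {rmorphism k -> E}).
Hypothesis ww' : forall c, w (iota c) = w' c.

Definition line : {rmorphism {mpoly k[n]} -> {poly E}} :=
  mmap (polyC \o w') (fun i => (w (P i))%:P + 'X * ((w' (v i))%:P - (w (P i))%:P)).

Lemma line0 p : (line p).[0] = w (mmap iota P p).
Proof.
apply: (@mmap_rmorph_eq k n _ (horner_eval 0 \o line) (w \o mmap iota P)) => [c|i].
  by rewrite /= !mmapC /= /horner_eval hornerC ww'.
by rewrite /= !mmapX !mmap1U /horner_eval !hornerE.
Qed.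

Lemma line1 p : (line p).[1] = w' p.@[v].
Proof.
apply: (@mmap_rmorph_eq k n _ (horner_eval 1 \o line) (w' \o meval v)) => [c|i].
  by rewrite /= !mmapC /= /horner_eval hornerC mevalC.
by rewrite /= !mmapX !mmap1U /horner_eval !hornerE mevalXU /=; ring.
Qed.

End Line.

Theorem liftable_split a b c d : infinite_set [set: k]%classic ->
  (forall zs, liftable zs) -> a != 0 -> b != 0 -> c != 0 -> d != 0 ->
  [/\ qsplit a b, qsplit b c, qsplit a d & qsplit (a * b) (c * d)] ->
  exists (k' : fieldType) (j : {rmorphism k -> k'}),
  forall (E : fieldType) (w : {rmorphism L -> E}) (w' : {rmorphism k' -> E}),
    (forall u, w (iota u) = w' (j u)) -> qsplit (w a) (w c).
Proof.
move=> kinf lift a0 b0 c0 d0 [[x1 [y1 [z1 [n1 e1]]]] [x2 [y2 [z2 [n2 e2]]]]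
  [x3 [y3 [z3 [n3 e3]]]] [x4 [y4 [z4 [n4 e4]]]]].
have [n [P [num [t [t0 numE cubic quartic]]]]] :=
  lift [:: 1; a; b; c; d; x1; y1; z1; x2; y2; z2; x3; y3; z3; x4; y4; z4].
set zs := (X in forall z, z \in X -> _) in numE cubic quartic.
pose ev : {rmorphism {mpoly k[n]} -> L} := mmap iota P; pose V := num 1.
have evn z : z \in zs -> ev (num z) = t * z by apply: numE.
have evV : ev V = t by rewrite evn ?mulr1 // inE eqxx.
(* The extra factor [V] makes the value at the generic point z times the square t^2, which leaves
   symbols unchanged, and turns the homogenised relations into conics. *)
pose lead z := V * num z.
have evl z : z \in zs -> ev (lead z) = z * t ^+ 2.
  by move=> zz; rewrite rmorphM evV evn //; ring.
have inz i : (i < 17)%N -> nth 0 zs i \in zs by move=> ?; apply: mem_nth.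
have [az bz cz dz] : [/\ a \in zs, b \in zs, c \in zs & d \in zs].
  by split; [apply: (inz 1%N) | apply: (inz 2%N) | apply: (inz 3%N) | apply: (inz 4%N)].
have tt0 : t ^+ 2 != 0 by rewrite expf_neq0.
have nzM z : z != 0 -> z * t ^+ 2 != 0 by move=> ?; rewrite mulf_neq0.
(* Yields a k-point where neither entry of the lifted symbol (a, c) vanishes. *)
have q0 : lead a * lead c != 0.
  by apply: contraTneq (mulf_neq0 (nzM _ a0) (nzM _ c0)) => q0; rewrite -!evl // -rmorphM q0 rmorph0 eqxx.
have [v] := mpoly_nonvanishing kinf q0; rewrite mevalM mulf_eq0 negb_or => /andP[va vc].
have [k1 [j1 [i1 i1E]]] := adjoin_sqrt (- 1 : k).
have [k' [j2 [r rE]]] := adjoin_sqrt (j1 (lead a).@[v]).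
exists k', (j2 \o j1) => E w w' ww'.
pose l := line P v w (w' \o (j2 \o j1)).
have l0 p : (l p).[0] = w (ev p) by apply: line0.
have l1 p : (l p).[1] = w' (j2 (j1 p.@[v])) by apply: line1.
have ii2 : (w' (j2 i1)) ^+ 2 = - 1.
  by rewrite -!rmorphXn i1E !rmorphN !rmorph1.
have neq0 p : ev p != 0 -> l p != 0.
  by move=> p0; apply: contraNneq p0 => lp; rewrite -(fmorph_eq0 w) -l0 lp horner0.
have split3 f g x y z : f \in zs -> g \in zs -> x \in zs -> y \in zs -> z \in zs ->
    [|| x != 0, y != 0 | z != 0] -> x ^+ 2 = f * y ^+ 2 + g * z ^+ 2 ->
    qsplit (l (lead f)) (l (lead g)).
  move=> fz gz xz yz zz nz e; exists (l (lead x)), (l (num y)), (l (num z)); split; last first.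
    rewrite -!rmorphXn -!rmorphM -rmorphD; congr (l _); rewrite /lead.
    transitivity (V * (V * num x ^+ 2)); first by ring.
    by rewrite (cubic f g x y z) //; ring.
  case/or3P: nz => u0.
  - by rewrite neq0 // evl // mulf_neq0.
  - by rewrite (neq0 (num y)) ?orbT // evn // mulf_neq0.
  - by rewrite (neq0 (num z)) ?orbT // evn // mulf_neq0.
have nzl u : u \in zs -> u != 0 -> l (lead u) != 0.
  by move=> uz u0; rewrite neq0 // evl // mulf_neq0.
have := @qsplit_line E (w' (j2 i1)) ii2 (l (lead a)) (l (lead b)) (l (lead c)) (l (lead d)) (w' r).
have l0E u : u \in zs -> (l (lead u)).[0] = w u * w t ^+ 2.
  by move=> uz; rewrite l0 evl // rmorphM [w (t ^+ 2)]rmorphXn.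
have l1a : (l (lead a)).[1] = w' r ^+ 2 by rewrite l1 -rE rmorphXn.
have l1n p : p.@[v] != 0 -> (l p).[1] != 0 by move=> p0; rewrite l1 !fmorph_eq0.
rewrite !l0E // => main.
have wt0 : w t != 0 by rewrite fmorph_eq0.
suff : qsplit (w a * w t ^+ 2) (w c * w t ^+ 2).
  by rewrite qsplit_mulsq // => /qsplitC; rewrite qsplit_mulsq // => /qsplitC.
apply: main l1a; try exact: nzl; try exact: l1n; try by rewrite mulf_neq0 ?expf_neq0 ?fmorph_eq0.
split.
- exact: (split3 a b x1 y1 z1 az bz (inz 5%N isT) (inz 6%N isT) (inz 7%N isT) n1 e1).
- exact: (split3 b c x2 y2 z2 bz cz (inz 8%N isT) (inz 9%N isT) (inz 10%N isT) n2 e2).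
- exact: (split3 a d x3 y3 z3 az dz (inz 11%N isT) (inz 12%N isT) (inz 13%N isT) n3 e3).
have [xz yz zz] : [/\ x4 \in zs, y4 \in zs & z4 \in zs].
  by split; [apply: (inz 14%N) | apply: (inz 15%N) | apply: (inz 16%N)].
exists (l (V ^+ 2 * num x4)), (l (num y4)), (l (num z4)); split.
  case/or3P: n4 => u0.
  - by rewrite neq0 // rmorphM rmorphXn evV evn // !mulf_neq0 ?expf_neq0.
  - by rewrite (neq0 (num y4)) ?orbT // evn // mulf_neq0.
  - by rewrite (neq0 (num z4)) ?orbT // evn // mulf_neq0.
rewrite -!rmorphM -!rmorphXn -!rmorphM -rmorphD; congr (l _); rewrite /lead.
transitivity (V ^+ 2 * (V ^+ 2 * num x4 ^+ 2)); first by ring.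
by rewrite (quartic a b c d x4 y4 z4) //; ring.
Qed.

End Lifting.

(** * Retract rational extensions are liftable *)

Section RetractLiftable.
Variables (k L : fieldType) (iota : {rmorphism k -> L}).

Lemma common_denominator (A : subringClosed L) :
  (forall z, exists a b, [/\ a \in A, b \in A, b != 0 & z = a / b]) ->
  forall zs : seq L, exists v, [/\ v != 0, v \in A & forall z, z \in zs -> v * z \in A].
Proof.
move=> frac; elim=> [|z zs [v [v0 vA vzs]]]; first by exists 1; rewrite oner_neq0 rpred1.
have [a [b [aA bA b0 ->]]] := frac z; exists (v * b); split.
- by rewrite mulf_neq0.
- by rewrite rpredM.
move=> y; rewrite inE => /orP[/eqP->|/vzs yA].
  by rewrite -mulrA (mulrC b) divfK // rpredM.
by rewrite mulrAC rpredM.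
Qed.

Section PolynomialsInLocalization.
Variables (n : nat) (f : {mpoly k[n]}) (f0 : f != 0).

Lemma tofrac_loc p : tofrac p \in loc f0.
Proof. by apply/locpP; exists p, 0%N; rewrite expr0 divr1. Qed.

Definition inc_fun p : subring (loc f0) := Subring (tofrac_loc p).

Lemma inc_is_zmod_morphism : zmod_morphism inc_fun.
Proof. by move=> p q; apply: val_inj; rewrite /= tofracB. Qed.

Lemma inc_is_monoid_morphism : monoid_morphism inc_fun.
Proof. by split=> [|p q]; apply: val_inj; rewrite /= ?tofrac1 ?tofracM. Qed.

HB.instance Definition _ := GRing.isZmodMorphism.Build _ _ inc_fun inc_is_zmod_morphism.
HB.instance Definition _ := GRing.isMonoidMorphism.Build _ _ inc_fun inc_is_monoid_morphism.

Definition inc : {rmorphism {mpoly k[n]} -> subring (loc f0)} := inc_fun.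

Lemma inc_inj : injective inc.
Proof. by move=> p q /(congr1 val) /= /eqP; rewrite tofrac_eq => /eqP. Qed.

Lemma inc_unit : exists g, inc f * g = 1.
Proof.
have fi : 1 / tofrac f \in loc f0 by apply/locpP; exists 1, 1%N; rewrite tofrac1 expr1.
by exists (Subring fi); apply: val_inj; rewrite /= mul1r divff // tofrac_eq0.
Qed.

Lemma inc_clear (y : subring (loc f0)) : exists n p, y * inc f ^+ n = inc p.
Proof.
have /locpP[p [l e]] := valP y; exists l, p; apply: val_inj.
pose vr : {rmorphism subring (loc f0) -> ratfun k n} := val.
have ey : vr y = tofrac p / tofrac f ^+ l := e.
change (vr (y * inc f ^+ l) = tofrac p); rewrite (rmorphM vr) (rmorphXn vr) ey.
by rewrite [vr (inc f)]/= divfK // expf_neq0 // tofrac_eq0.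
Qed.

End PolynomialsInLocalization.

(** [phi] carries relations from A to polynomials over powers of [f], and [psi] evaluates at the
    point psi(X_i); psi phi = id returns the elements of L up to the factor psi(f)^N v. *)
Lemma retract_liftable : retract_rational iota -> forall zs, liftable iota zs.
Proof.
move=> [A [AC frac [n [f [f0 [phi [psi [phiC psiC psiphi]]]]]]]] zs.
pose zs1 := 1 :: zs.
have [v [v0 vA vz]] := common_denominator frac zs1.
pose vp : {rmorphism subring (loc f0) -> L} := val \o psi.
pose vps : {rmorphism {mpoly k[n]} -> L} := vp \o inc f0.
pose I := inc f0.
pose vA1 : {rmorphism subring A -> L} := val.
pose P i := vps 'X_i.
have evE p : mmap iota P p = vps p.
  apply: (@mmap_rmorph_eq k n _ (mmap iota P) vps) => [c|i]; last by rewrite /= mmapX mmap1U.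
  by rewrite /= mmapC; apply/esym/psiC.
have F0 : vps f != 0.
  have [g /(congr1 (val \o psi))] := inc_unit f0; rewrite /= rmorphM rmorph1 /= => e.
  by apply: contraTneq (oner_neq0 L) => F0; rewrite -e F0 mul0r eqxx.
(* One exponent for all elements makes the powers of [f] agree in a homogeneous relation. *)
have [N NP] : exists N, forall z, z \in zs1 -> exists (y : subring A) p,
    val y = v * z /\ phi y * I f ^+ N = I p.
  elim: (zs1) vz => [|z ys IH] vz; first by exists 0%N.
  have [|N NP] := IH; first by move=> u uy; apply: vz; rewrite inE uy orbT.
  have zA : v * z \in A by apply: vz; rewrite inE eqxx.
  have [l [p lp]] := inc_clear (phi (Subring zA)).
  exists (N + l)%N => u; rewrite inE => /orP[/eqP->|/NP[y [q [yE qE]]]].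
    exists (Subring zA), (p * f ^+ N); split=> //.
    by rewrite addnC exprD mulrA lp rmorphM rmorphXn.
  by exists y, (q * f ^+ l); split=> //; rewrite exprD mulrA qE rmorphM rmorphXn.
have /choice[Y /choice[num numP]] : forall z, exists y p, z \in zs1 ->
    val y = v * z /\ phi y * I f ^+ N = I p.
  move=> z; case: (boolP (z \in zs1)) => [/NP[y [p yp]]|nz]; first by exists y, p.
  by exists 0, 0.
have in1 z : z \in zs -> z \in zs1 by move=> zz; rewrite inE zz orbT.
have one : 1 \in zs1 by rewrite inE eqxx.
exists n, P, num, (vps f ^+ N * v); split.
- by rewrite mulf_neq0 ?expf_neq0.
- move=> z /in1/numP[yE pE]; rewrite evE.
  change (vp (inc f0 (num z)) = vp (inc f0 f) ^+ N * v * z).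
  rewrite -pE (rmorphM vp) (rmorphXn vp) (_ : vp _ = v * z); last by rewrite -yE /= psiphi.
  by rewrite mulrC mulrA.
- move=> a b x y z /in1/numP[a1 a2] /in1/numP[b1 b2] /in1/numP[x1 x2] /in1/numP[y1 y2] /in1/numP[z1 z2] e.
  have [u1 u2] := numP _ one; apply: (@inc_inj _ _ f0).
  rewrite (rmorphD I) !(rmorphM I) ?(rmorphXn I) -a2 -b2 -x2 -y2 -z2 -u2.
  (* Homogeneity of degree 3: multiplying by v^3 moves the relation from L into A. *)
  have e' : Y 1 * Y x ^+ 2 = Y a * Y y ^+ 2 + Y b * Y z ^+ 2.
    apply: val_inj; change (vA1 (Y 1 * Y x ^+ 2) = vA1 (Y a * Y y ^+ 2 + Y b * Y z ^+ 2)).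
    rewrite (rmorphD vA1) !(rmorphM vA1) ?(rmorphXn vA1) [vA1 (Y 1)]u1 [vA1 (Y a)]a1 [vA1 (Y b)]b1.
    by rewrite [vA1 (Y x)]x1 [vA1 (Y y)]y1 [vA1 (Y z)]z1; transitivity (v ^+ 3 * x ^+ 2); [ring | rewrite e; ring].
  have := congr1 phi e'; rewrite (rmorphD phi) !(rmorphM phi) ?(rmorphXn phi) => e''.
  transitivity ((phi (Y 1) * (phi (Y x) * phi (Y x))) * (I f ^+ N) ^+ 3); first by ring.
  by rewrite e''; ring.
move=> a b c d x y z /in1/numP[a1 a2] /in1/numP[b1 b2] /in1/numP[c1 c2] /in1/numP[d1 d2]
  /in1/numP[x1 x2] /in1/numP[y1 y2] /in1/numP[z1 z2] e.
have [u1 u2] := numP _ one; apply: (@inc_inj _ _ f0).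
rewrite (rmorphD I) !(rmorphM I) ?(rmorphXn I) -a2 -b2 -c2 -d2 -x2 -y2 -z2 -u2.
have e' : Y 1 ^+ 2 * Y x ^+ 2 = Y a * Y b * Y y ^+ 2 + Y c * Y d * Y z ^+ 2.
  apply: val_inj.
  change (vA1 (Y 1 ^+ 2 * Y x ^+ 2) = vA1 (Y a * Y b * Y y ^+ 2 + Y c * Y d * Y z ^+ 2)).
  rewrite (rmorphD vA1) !(rmorphM vA1) ?(rmorphXn vA1) [vA1 (Y 1)]u1 [vA1 (Y a)]a1 [vA1 (Y b)]b1.
  rewrite [vA1 (Y c)]c1 [vA1 (Y d)]d1 [vA1 (Y x)]x1 [vA1 (Y y)]y1 [vA1 (Y z)]z1.
  transitivity (v ^+ 4 * x ^+ 2); first by ring.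
  by rewrite e; ring.
have := congr1 phi e'; rewrite (rmorphD phi) !(rmorphM phi) ?(rmorphXn phi) => e''.
transitivity ((phi (Y 1) * phi (Y 1) * (phi (Y x) * phi (Y x))) * (I f ^+ N) ^+ 4); first by ring.
by rewrite e''; ring.
Qed.

End RetractLiftable.

(** * Rational extensions are liftable *)

Section RationalLiftable.
Variables (k L : fieldType) (iota : {rmorphism k -> L}).

Definition seq_val (r : seq L) : {rmorphism {mpoly k[size r]} -> L} :=
  mmap iota (fun i => r`_i).

Lemma seq_val_widen (n : nat) (s : 'I_n -> L) (r : seq L) :
  (forall i, s i \in r) -> forall p : {mpoly k[n]}, exists q, seq_val r q = mmap iota s p.
Proof.
move=> sr p; have idx i : (index (s i) r < size r)%N by rewrite index_mem.
pose t : {rmorphism {mpoly k[n]} -> {mpoly k[size r]}} :=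
  mmap (@mpolyC _ _) (fun i => 'X_(Ordinal (idx i))).
exists (t p); apply: (@mmap_rmorph_eq k n _ (seq_val r \o t) (mmap iota s)) => [c|i].
  by rewrite /= !mmapC.
by rewrite /= !mmapX !mmap1U mmapX mmap1U /= nth_index.
Qed.

(** Finitely many elements involve finitely many members of B; repetitions are removed because
    independence is stated for injective tuples. *)
Lemma field_generated_common (B : set L) : field_generated iota B -> forall zs : seq L,
  exists r : seq L, [/\ uniq r, forall x, x \in r -> B x &
    exists q, seq_val r q != 0 /\ forall z, z \in zs -> exists p, seq_val r p = seq_val r q * z].
Proof.
move=> gen; elim=> [|z zs [r [ur rB [q [q0 qz]]]]].
  by exists [::]; split=> //; exists 1; rewrite rmorph1 oner_neq0.
have [n [s [p' [q' [sB q'0 ez]]]]] := gen z.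
pose r' := undup (r ++ [seq s i | i <- enum 'I_n]).
have r'B x : x \in r' -> B x.
  by rewrite mem_undup mem_cat => /orP[/rB//|/mapP[i _ ->]]; apply: sB.
have wr p : exists q1, seq_val r' q1 = seq_val r p.
  by apply: seq_val_widen => i; rewrite mem_undup mem_cat mem_nth.
have ws p : exists q1, seq_val r' q1 = mmap iota s p.
  by apply: seq_val_widen => i; rewrite mem_undup mem_cat map_f ?orbT // mem_enum.
have [q1 q1E] := wr q; have [q2 q2E] := ws q'; have [p2 p2E] := ws p'.
exists r'; split=> //; first exact: undup_uniq.
exists (q1 * q2); split; first by rewrite rmorphM q1E q2E mulf_neq0.
move=> y; rewrite inE => /orP[/eqP->|/qz[p pE]].
  by exists (q1 * p2); rewrite !rmorphM q2E p2E ez -mulrA (mulrC (mmap iota s q')) divfK.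
have [p1 p1E] := wr p; exists (p1 * q2).
by rewrite !rmorphM p1E q1E pE mulrAC.
Qed.

(** Evaluation at independent elements is injective, so relations in L already hold between the
    polynomials. *)
Lemma rational_liftable : rational iota -> forall zs, liftable iota zs.
Proof.
move=> [B [ind gen]] zs.
have [r [ur rB [q [q0 qz]]]] := field_generated_common gen (1 :: zs).
have inj0 p : seq_val r p = 0 -> p = 0.
  apply: ind => [i i' /eqP|i]; last by apply/rB/mem_nth.
  by rewrite nth_uniq // => /eqP/val_inj.
have inj p p' : seq_val r p = seq_val r p' -> p = p'.
  by move=> e; apply/eqP; rewrite -subr_eq0; apply/eqP/inj0; rewrite rmorphB e subrr.
have /choice[num numP] : forall z, exists p, z \in 1 :: zs -> seq_val r p = seq_val r q * z.
  move=> z; case: (boolP (z \in 1 :: zs)) => [/qz[p pE]|_]; first by exists p.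
  by exists 0.
have numE z : z \in zs -> seq_val r (num z) = seq_val r q * z.
  by move=> zz; apply: numP; rewrite inE zz orbT.
have num1 : seq_val r (num 1) = seq_val r q by rewrite numP ?mulr1 // inE eqxx.
exists (size r), (fun i => r`_i), num, (seq_val r q); split=> //.
  move=> a b x y z az bz xz yz zz e; apply: inj.
  rewrite rmorphD !rmorphM ?rmorphXn num1 !numE //.
  by transitivity (seq_val r q ^+ 3 * x ^+ 2); [ring | rewrite e; ring].
move=> a b c d x y z az bz cz dz xz yz zz e; apply: inj.
rewrite rmorphD !rmorphM ?rmorphXn num1 !numE //.
by transitivity (seq_val r q ^+ 4 * x ^+ 2); [ring | rewrite e; ring].
Qed.

End RationalLiftable.

(** * The relations between a, b, c, d *)

Section SymbolRelations.
Variable K : fieldType.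

(** First and third arguments are paired, as are second and fourth. When the product of all four is
    1, this is (1 + u1 u3)^2 / (u1 u3). *)
Definition pair_sum (u1 u2 u3 u4 : K) : K := 2%:R + u1 * u3 + u2 * u4.
Definition pair_diff (u1 u2 u3 u4 : K) : K := u1 * u3 - u2 * u4.
Definition sym_sum (u1 u2 u3 u4 : K) : K :=
  u1 + u2 + u3 + u4 + (u2 * u3 * u4 + u1 * u3 * u4 + u1 * u2 * u4 + u1 * u2 * u3).

(* The last sum is e_1 + e_3, whose square is the product of the three
   pair sums because u1 u2 u3 u4 = 1. *)
Definition invariants (u1 u2 u3 u4 S T : K) : seq K :=
  [:: (S ^+ 2 - T ^+ 2) ^+ 2; (2%:R * S * T) ^+ 2;
      pair_sum u1 u2 u3 u4; pair_sum u1 u2 u4 u3;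
      S ^+ 2 + T ^+ 2; pair_diff u1 u2 u3 u4 / (2%:R * S * T);
      pair_diff u1 u2 u4 u3 / (S ^+ 2 - T ^+ 2); pair_sum u1 u3 u2 u4;
      pair_diff u1 u3 u2 u4 / ((S ^+ 2 - T ^+ 2) * (2%:R * S * T));
      2%:R * sym_sum u1 u2 u3 u4 / (pair_sum u1 u2 u3 u4 * pair_sum u1 u2 u4 u3)].

Lemma map_invariants (L : fieldType) (g : {rmorphism K -> L}) (u1 u2 u3 u4 S T : K) :
  map g (invariants u1 u2 u3 u4 S T) =
  [:: (g S ^+ 2 - g T ^+ 2) ^+ 2; (2%:R * g S * g T) ^+ 2;
      2%:R + g u1 * g u3 + g u2 * g u4; 2%:R + g u1 * g u4 + g u2 * g u3;
      g S ^+ 2 + g T ^+ 2; (g u1 * g u3 - g u2 * g u4) / (2%:R * g S * g T);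
      (g u1 * g u4 - g u2 * g u3) / (g S ^+ 2 - g T ^+ 2);
      2%:R + g u1 * g u2 + g u3 * g u4;
      (g u1 * g u2 - g u3 * g u4) / ((g S ^+ 2 - g T ^+ 2) * (2%:R * g S * g T));
      2%:R * (g u1 + g u2 + g u3 + g u4 + (g u2 * g u3 * g u4 + g u1 * g u3 * g u4 +
         g u1 * g u2 * g u4 + g u1 * g u2 * g u3)) /
      ((2%:R + g u1 * g u3 + g u2 * g u4) * (2%:R + g u1 * g u4 + g u2 * g u3))].
Proof.
by rewrite /invariants /pair_sum /pair_diff /sym_sum /= !(fmorphV, rmorphN, rmorphXn, rmorphD, rmorphM, rmorph1).
Qed.

Variables (u1 u2 u3 u4 S T : K).
Local Notation invs := (invariants u1 u2 u3 u4 S T).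

(** Each difference of pairs and the expression in S, T that divides it change sign together or not
    at all. *)
Lemma invariants_rho (g : {rmorphism K -> K}) :
  g S = T -> g T = - S -> g u1 = u2 -> g u2 = u1 -> g u3 = u4 -> g u4 = u3 -> map g invs = invs.
Proof.
move=> gS gT g1 g2 g3 g4; rewrite map_invariants gS gT g1 g2 g3 g4 sqrrN /invariants.
have e1 : T ^+ 2 - S ^+ 2 = - (S ^+ 2 - T ^+ 2) by ring.
have e2 : 2%:R * T * - S = - (2%:R * S * T) by ring.
have dN (x y : K) : - x / - y = x / y by rewrite invrN mulrNN.
rewrite e1 e2 !sqrrN mulrNN /pair_sum /pair_diff /sym_sum.
congr [:: _; _; _; _; _; _; _; _; _; _].
- by rewrite -addrA [u2 * _ + _]addrC addrA.
- by rewrite -addrA [u2 * _ + _]addrC addrA.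
- by rewrite addrC.
- by rewrite -dN opprK opprB.
- by rewrite -dN opprK opprB.
- by rewrite (mulrC u2) (mulrC u4).
- by rewrite (mulrC u2) (mulrC u4).
by congr (_ / _); ring.
Qed.

Lemma invariants_tau (g : {rmorphism K -> K}) :
  g S = T -> g T = S -> g u1 = u3 -> g u2 = u4 -> g u3 = u1 -> g u4 = u2 -> map g invs = invs.
Proof.
move=> gS gT g1 g2 g3 g4; rewrite map_invariants gS gT g1 g2 g3 g4 /invariants.
have e1 : T ^+ 2 - S ^+ 2 = - (S ^+ 2 - T ^+ 2) by ring.
have e2 : 2%:R * T * S = 2%:R * S * T by ring.
have dN (x y : K) : - x / - y = x / y by rewrite invrN mulrNN.
rewrite e1 e2 !sqrrN mulNr /pair_sum /pair_diff /sym_sum.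
congr [:: _; _; _; _; _; _; _; _; _; _].
- by rewrite (mulrC u3) (mulrC u4).
- by rewrite (mulrC u3) (mulrC u4); ring.
- by rewrite addrC.
- by rewrite (mulrC u3) (mulrC u4).
- by rewrite -dN opprK opprB; congr (_ / _); ring.
- by ring.
- by rewrite -dN opprK opprB; congr (_ / _); ring.
by congr (_ / _); ring.
Qed.

Hypotheses (prod1 : u1 * u2 * u3 * u4 = 1).

Lemma pair_sum_sqr v1 v2 v3 v4 : v1 * v2 * v3 * v4 = 1 ->
  pair_sum v1 v2 v3 v4 ^+ 2 = pair_diff v1 v2 v3 v4 ^+ 2 + pair_sum v1 v2 v3 v4 * 2%:R ^+ 2.
Proof.
move=> e; rewrite /pair_sum /pair_diff; apply/eqP; rewrite -subr_eq0; apply/eqP.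
by transitivity (4%:R * (v1 * v2 * v3 * v4 - 1)); [ring | rewrite e subrr mulr0].
Qed.

Lemma pair_sum_neq0 v1 v2 v3 v4 : v1 * v2 * v3 * v4 = 1 -> 1 + v1 * v3 != 0 ->
  pair_sum v1 v2 v3 v4 != 0.
Proof.
move=> e v0; apply: contraTneq (mulf_neq0 v0 v0) => p0; rewrite negbK; apply/eqP.
transitivity (v1 * v3 * pair_sum v1 v2 v3 v4 + (1 - v1 * v2 * v3 * v4)); last first.
  by rewrite p0 e subrr mulr0 addr0.
by rewrite /pair_sum; ring.
Qed.

(** The factors are (1 + u1 uj)^2 / (u1 uj) for j = 2, 3, 4; the denominators multiply to u1^2, and
    the 1 + u1 uj to u1 times [sym_sum]. *)
Lemma pair_sum_prod :
  pair_sum u1 u2 u3 u4 * pair_sum u1 u2 u4 u3 * pair_sum u1 u3 u2 u4 = sym_sum u1 u2 u3 u4 ^+ 2.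
Proof.
have u10 : u1 != 0 by apply: contraTneq (oner_neq0 K) => u0; rewrite -prod1 u0 !mul0r eqxx.
have u20 : u2 != 0 by apply: contraTneq (oner_neq0 K) => u0; rewrite -prod1 u0 mulr0 !mul0r eqxx.
have u30 : u3 != 0 by apply: contraTneq (oner_neq0 K) => u0; rewrite -prod1 u0 mulr0 mul0r eqxx.
have -> : u4 = 1 / (u1 * u2 * u3).
  by rewrite -prod1 mulrAC divff ?mul1r // !mulf_neq0.
by rewrite /pair_sum /sym_sum; field; rewrite u10 u20 u30.
Qed.

End SymbolRelations.

Lemma fixed_by_generators (k K : fieldType) (iota : {rmorphism k -> K}) (G : finGroupType)
    (act : kaction iota G) (A : {set G}) (z : K) :
  <<A>>%g = [set: G]%SET -> (forall g, g \in A -> act g z = z) -> z \in fixed act.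
Proof.
move=> genA fA; apply/fixedP => g.
have stab_group : group_set [set g | act g z == z]%SET.
  apply/group_setP; split=> [|x y]; first by rewrite inE kact1.
  by rewrite !inE kactM => /eqP xz /eqP->; apply/eqP.
have : (<<A>> \subset Group stab_group)%g.
  by rewrite gen_subG; apply/fintype.subsetP=> x xA; rewrite inE fA.
by rewrite genA => /fintype.subsetP/(_ g); rewrite inE => /(_ isT); rewrite inE => /eqP.
Qed.

Lemma tofrac_meval_neq0 (k : fieldType) (n : nat) (p : {mpoly k[n]}) v :
  p.@[v] != 0 -> tofrac p != 0.
Proof. by rewrite tofrac_eq0; apply: contraNneq => ->; rewrite meval0. Qed.

Lemma cayley_inv (K : fieldType) (x : K) : x != 0 -> cayley (1 / x) = - cayley x.
Proof.
move=> x0; rewrite /cayley div1r.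
(* At x = -1 both sides are 0, by the convention for the inverse of 0. *)
have [x1|x1] := eqVneq (x + 1) 0.
  have -> : x = - 1 by apply/eqP; rewrite -addr_eq0 x1.
  by rewrite invrN invr1 addNr invr0 !mulr0 oppr0.
by field; rewrite x1 x0.
Qed.

Lemma cayley_sqrB_neq0 (K : fieldType) (x y : K) : (2%:R : K) != 0 ->
  x + 1 != 0 -> y + 1 != 0 -> x - y != 0 -> x * y - 1 != 0 ->
  cayley x ^+ 2 - cayley y ^+ 2 != 0.
Proof.
move=> K2 x1 y1 xy xy1.
have -> : cayley x ^+ 2 - cayley y ^+ 2 =
    (2%:R * (x - y)) * (2%:R * (x * y - 1)) / ((x + 1) ^+ 2 * (y + 1) ^+ 2).
  by rewrite /cayley; field; rewrite x1 y1.
by rewrite !mulf_neq0 // invr_eq0 mulf_neq0 ?expf_neq0.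
Qed.

Section Symbols.
Variables (k K : fieldType) (iota : {rmorphism k -> K}).
Variables (G : finGroupType) (rho tau : G) (act : kaction iota G).
Hypothesis K2 : (2%:R : K) != 0.
Hypothesis G_gen : <<[set rho; tau]%SET>>%g = [set: G]%SET.
Variables x1 x2 x3 x4 x5 : K.
Hypothesis act_rho : [/\ act rho x1 = x2, act rho x2 = x1,
  act rho x3 = 1 / (x1 * x2 * x3), act rho x4 = x5 & act rho x5 = 1 / x4].
Hypothesis act_tau : [/\ act tau x1 = x3, act tau x2 = 1 / (x1 * x2 * x3),
  act tau x3 = x1, act tau x4 = x5 & act tau x5 = x4].
Hypotheses (x10 : x1 != 0) (x20 : x2 != 0) (x30 : x3 != 0) (x40 : x4 != 0).
Hypotheses (x12 : 1 + x1 * x2 != 0) (x13 : 1 + x1 * x3 != 0) (x23 : 1 + x2 * x3 != 0).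
Hypotheses (p4 : x4 + 1 != 0) (m4 : x4 - 1 != 0) (p5 : x5 + 1 != 0) (m5 : x5 - 1 != 0).
Hypotheses (xy : x4 - x5 != 0) (xy1 : x4 * x5 - 1 != 0).

Let u4 := 1 / (x1 * x2 * x3).
Let S := cayley x4.
Let T := cayley x5.

(** The last relation encodes (a,c) = (b,d): expand (ab, cd) and use (a,d) = (b,c) = 0. *)
Lemma symbol_relations : exists a b c d : fixed_field act,
  [/\ val a = slot_a x4 x5, val c = slot_c x1 x2 x3,
   [/\ a != 0, b != 0, c != 0 & d != 0] &
   [/\ qsplit a b, qsplit b c, qsplit a d & qsplit (a * b) (c * d)]].
Proof.
have [ar1 ar2 ar3 ar4 ar5] := act_rho; have [at1 at2 at3 at4 at5] := act_tau.
have prod0 : x1 * x2 * x3 != 0 by rewrite !mulf_neq0.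
have prod1 : x1 * x2 * x3 * u4 = 1 by rewrite /u4 div1r divff.
have ar4u : act rho u4 = x3.
  by rewrite /u4 fmorph_div rmorph1 !rmorphM ar1 ar2 ar3; field; rewrite x10 x20 x30 ?oner_neq0.
have at4u : act tau u4 = x2.
  by rewrite /u4 fmorph_div rmorph1 !rmorphM at1 at2 at3; field; rewrite x10 x20 x30 ?oner_neq0.
pose invs := invariants x1 x2 x3 u4 S T.
have fix_rho : map (act rho) invs = invs.
  apply: invariants_rho => //; rewrite ?rmorph_cayley ?ar4 ?ar5 //; exact: cayley_inv.
have fix_tau : map (act tau) invs = invs.
  by apply: invariants_tau => //; rewrite ?rmorph_cayley ?at4 ?at5.
have invs_fixed z : z \in invs -> z \in fixed act.
  move=> zi; apply: (fixed_by_generators G_gen) => g; rewrite !inE => /orP[] /eqP->.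
    have /eq_in_map H : map (act rho) invs = map id invs by rewrite map_id.
    exact: H.
  have /eq_in_map H : map (act tau) invs = map id invs by rewrite map_id.
  exact: H.
have el i : (i < 10)%N -> exists l : fixed_field act, val l = nth 0 invs i.
  by move=> li; exists (FixedField (invs_fixed _ (mem_nth 0 (li : i < size invs)%N))).
have [a va] := el 0%N isT; have [b vb] := el 1%N isT; have [c vc] := el 2%N isT.
have [d vd] := el 3%N isT; have [s vs] := el 4%N isT; have [y2 vy2] := el 5%N isT.
have [y3 vy3] := el 6%N isT; have [e ve] := el 7%N isT; have [y4 vy4] := el 8%N isT.
have [z4 vz4] := el 9%N isT.
rewrite /= in va vb vc vd vs vy2 vy3 ve vy4 vz4.
have ST0 : S ^+ 2 - T ^+ 2 != 0 by apply: cayley_sqrB_neq0.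
have S0 : S != 0 by rewrite /S /cayley mulf_neq0 ?invr_eq0.
have T0 : T != 0 by rewrite /T /cayley mulf_neq0 ?invr_eq0.
have ST2 : 2%:R * S * T != 0 by apply: mulf_neq0 => //; apply: mulf_neq0.
have c0 : pair_sum x1 x2 x3 u4 != 0 by apply: pair_sum_neq0.
have prod2 : x1 * x2 * u4 * x3 = 1 by rewrite mulrAC.
have prod3 : x1 * x3 * x2 * u4 = 1 by rewrite (mulrAC x1).
have d0 : pair_sum x1 x2 u4 x3 != 0.
  apply: pair_sum_neq0 => //.
  apply: contra_neq x23 => /(congr1 ( *%R^~ (x2 * x3))); rewrite mul0r mulrDl mul1r.
  by rewrite (_ : x1 * u4 * (x2 * x3) = 1) 1?addrC // -prod1; ring.
have e0 : pair_sum x1 x3 x2 u4 != 0 by apply: pair_sum_neq0.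
pose v : {rmorphism fixed_field act -> K} := val.
have v_inj : injective v := val_inj.
have v0 z : v z != 0 -> z != 0 by rewrite fmorph_eq0.
have L2 : (2%:R : fixed_field act) != 0 by apply: v0; rewrite rmorph_nat.
have [{}va {}vb {}vc {}vd] : [/\ v a = (S ^+ 2 - T ^+ 2) ^+ 2, v b = (2%:R * S * T) ^+ 2,
    v c = pair_sum x1 x2 x3 u4 & v d = pair_sum x1 x2 u4 x3] by [].
have clear (w q : K) : w != 0 -> w ^+ 2 * (q / w) ^+ 2 = q ^+ 2.
  by move=> w0; rewrite -exprMn mulrC divfK.
have v2 : v 2%:R = 2%:R by rewrite rmorph_nat.
exists a, b, c, d; split=> //.
  by split; apply: v0; rewrite ?va ?vb ?vc ?vd //; apply: expf_neq0.
split.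
(* (S^2 + T^2)^2 = (S^2 - T^2)^2 + (2ST)^2. *)
- exists s, 1, 1; rewrite oner_neq0 !orbT; split=> //; apply: v_inj.
  rewrite (rmorphXn v) (rmorphD v) !expr1n !mulr1 va vb [v s]vs; ring.
- exists c, y2, 2%:R; rewrite L2 !orbT; split=> //; apply: v_inj.
  rewrite [LHS](rmorphXn v) (rmorphD v) (rmorphM v b) (rmorphM v c) !(rmorphXn v).
  by rewrite v2 vb vc [v y2]vy2 clear // pair_sum_sqr.
- exists d, y3, 2%:R; rewrite L2 !orbT; split=> //; apply: v_inj.
  rewrite [LHS](rmorphXn v) (rmorphD v) (rmorphM v a) (rmorphM v d) !(rmorphXn v).
  by rewrite v2 va vd [v y3]vy3 clear // pair_sum_sqr.
(* [e] is the third pair sum: e^2 = a b y4^2 + 4 e, and c d e = [sym_sum]^2 makes 4 e equal to c d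
   z4^2. *)
exists e, y4, z4; split; first by rewrite v0 // [v e]ve.
apply: v_inj; rewrite [LHS](rmorphXn v) (rmorphD v) (rmorphM v (a * b)) (rmorphM v (c * d)).
rewrite (rmorphM v a) (rmorphM v c) !(rmorphXn v) va vb vc vd [v e]ve [v y4]vy4 [v z4]vz4.
rewrite -exprMn (clear _ _ (mulf_neq0 ST0 ST2)) pair_sum_sqr //; congr (_ + _).
set p := pair_sum x1 x2 x3 u4 * pair_sum x1 x2 u4 x3.
have p0 : p != 0 by apply: mulf_neq0.
transitivity (2%:R ^+ 2 * sym_sum x1 x2 x3 u4 ^+ 2 / p); last by field.
by rewrite -pair_sum_prod // -/p; field.
Qed.

End Symbols.

(** * Nonvanishing of expressions in the x_i, by evaluation at a point *)

Section Coordinates.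
Variable k : fieldType.
Let x4 := ratX k (inord 3 : 'I_5).
Let x5 := ratX k (inord 4 : 'I_5).

Lemma coord_neq0 (i : 'I_5) : ratX k i != 0.
Proof. by apply: (@tofrac_meval_neq0 _ _ _ (fun=> 1)); rewrite mevalXU oner_neq0. Qed.

Lemma coordM_neq0 (i j : 'I_5) : 1 + ratX k i * ratX k j != 0.
Proof.
rewrite -tofrac1 -tofracM -tofracD; apply: (@tofrac_meval_neq0 _ _ _ (fun=> 0)).
by rewrite mevalD mevalM meval1 !mevalXU mul0r addr0 oner_neq0.
Qed.

Lemma coord1_neq0 (i : 'I_5) : ratX k i + 1 != 0 /\ ratX k i - 1 != 0.
Proof.
rewrite -tofrac1 -tofracD -tofracB; split; apply: (@tofrac_meval_neq0 _ _ _ (fun=> 0)).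
  by rewrite mevalD mevalXU meval1 add0r oner_neq0.
by rewrite mevalB mevalXU meval1 sub0r oppr_eq0 oner_neq0.
Qed.

Lemma coordB_neq0 : x4 - x5 != 0 /\ x4 * x5 - 1 != 0.
Proof.
rewrite -tofrac1 -tofracM -!tofracB; split.
  apply: (@tofrac_meval_neq0 _ _ _ (fun i => (i == inord 3)%:R)).
  rewrite mevalB !mevalXU eqxx (_ : inord 4 == _ = false) ?subr0 ?oner_neq0 //.
  by apply/eqP => /(congr1 val); rewrite /= !inordK.
apply: (@tofrac_meval_neq0 _ _ _ (fun=> 0)).
by rewrite mevalB mevalM !mevalXU meval1 mul0r sub0r oppr_eq0 oner_neq0.
Qed.

End Coordinates.

Theorem theorem6p4 (k : fieldType) (k_inf : infinite_set [set: k]%classic)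
  (k_char : 2%N \notin [pchar k])
  (G : finGroupType) (rho tau : G)
  (G_gen : <<[set rho; tau]%SET>>%g = [set: G]%SET)
  (G_D4 : [set: G]%SET \isog 'D_8)
  (act : kaction (ratC k 5) G)
  (x1 := ratX k (inord 0 : 'I_5)) (x2 := ratX k (inord 1 : 'I_5))
  (x3 := ratX k (inord 2 : 'I_5)) (x4 := ratX k (inord 3 : 'I_5))
  (x5 := ratX k (inord 4 : 'I_5))
  (act_rho : [/\ act rho x1 = x2, act rho x2 = x1,
                 act rho x3 = 1 / (x1 * x2 * x3),
                 act rho x4 = x5 & act rho x5 = 1 / x4])
  (act_tau : [/\ act tau x1 = x3, act tau x2 = 1 / (x1 * x2 * x3),
                 act tau x3 = x1, act tau x4 = x5 & act tau x5 = x4]) :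
  ~ retract_rational (fixed_const act) /\ ~ rational (fixed_const act).
Proof.
have k2 : (2%:R : k) != 0 by move: k_char; rewrite inE.
have K2 : (2%:R : ratfun k 5) != 0 by rewrite -(rmorph_nat (ratC k 5)) fmorph_eq0.
have [[p4 m4] [p5 m5]] := (coord1_neq0 k (inord 3), coord1_neq0 k (inord 4)).
have [x45 x45'] := coordB_neq0 k.
have not_liftable : ~ forall zs, liftable (fixed_const act) zs.
  move=> lift; have [a [b [c [d [va vc [a0 b0 c0 d0] rel]]]]] :=
    symbol_relations K2 G_gen act_rho act_tau (coord_neq0 _ _) (coord_neq0 _ _) (coord_neq0 _ _)
      (coord_neq0 _ _) (coordM_neq0 _ _ _) (coordM_neq0 _ _ _) (coordM_neq0 _ _ _)
      p4 m4 p5 m5 x45 x45'.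
  have [k' [j split_ac]] := liftable_split k_inf lift a0 b0 c0 d0 rel.
  have [E [w [w' [ww' nsplit]]]] := nonsplit_extension j k_inf k2 act_rho act_tau.
  exact: nsplit va vc (split_ac E w w' ww').
by split=> [/retract_liftable | /rational_liftable]; apply: not_liftable.
Qed.
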